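(* Assume the polytopic dynamics and the SOS settings (i)–(iv) described in the context. Let initial decision variables $(w^{\{0\}},P^{\{0\}},r^{\{0\}})\in\mathbb{R}^{d_w}\times\mathbb{R}^{d_z\times d_z}\times\mathbb{R}^{d_r\times K}$ and constants $\rho_{\mathrm{ub}}\in\mathbb{R}$ (the constant in the definition of the penalty function $\rho$) and $\hat J_{\mathrm{lb}}\in\mathbb{R}$ be given such that $$P^{\{0\}}+(P^{\{0\}})^\top\succ0,\qquad T_k(w^{\{0\}},P^{\{0\}},r^{\{0\}})\succ0\ \ \text{for all }k\in\{1,\dots,K\},\qquad g(w^{\{0\}},P^{\{0\}},r^{\{0\}})<\hat J_{\mathrm{lb}}+\rho_{\mathrm{ub}}.$$ For any $\ell\in\{0,1,2,\dots\}$, if the gradient method $$w^{\{\ell+1\}}=w^{\{\ell\}}-\alpha_\ell\frac{\partial g}{\partial w}(w^{\{\ell\}},P^{\{\ell\}},r^{\{\ell\}}),\quad P^{\{\ell+1\}}=P^{\{\ell\}}-\alpha_\ell\frac{\partial\rho}{\partial P}(w^{\{\ell\}},P^{\{\ell\}},r^{\{\ell\}}),\quad r^{\{\ell+1\}}=r^{\{\ell\}}-\alpha_\ell\frac{\partial\rho}{\partial r}(w^{\{\ell\}},P^{\{\ell\}},r^{\{\ell\}})$$ (with step sizes $\alpha_\ell$) provides $(w^{\{\ell\}},P^{\{\ell\}},r^{\{\ell\}})$ satisfying $$g(w^{\{\ell\}},P^{\{\ell\}},r^{\{\ell\}})\le g(w^{\{0\}},P^{\{0\}},r^{\{0\}}),\qquad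 \mathrm{E}_\theta\big[\mathrm{E}_{x_0}[\hat J(x_0,v(w^{\{\ell\}},\theta))]\big]\ge\hat J_{\mathrm{lb}},$$ then the feedback system $\dot x(t,\theta)=f(x(t,\theta),\theta)+G(x(t,\theta),\theta)\,\hat u(x(t,\theta),w^{\{\ell\}})$, $x(0,\theta)=x_0$, is robustly globally asymptotically stable in the sense that $$\forall\theta\in\mathbb{S}_\theta,\ \forall x_0\in\mathbb{R}^{d_x},\quad\lim_{t\to\infty}x(t,\theta)=0.$$
   Context: Notation. $[\,\cdot\,]_i$, $[\,\cdot\,]_{i,j}$ denote components; $\mathrm{vec}$ is column-stacking vectorization, $\mathrm{vech}$ the half-vectorization (stacking the on-and-below-diagonal parts of the columns of a symmetric matrix), $\otimes$ the Kronecker product, $I_n$ the identity. Dynamics. $\theta\in\mathbb{S}_\theta\subseteq\mathbb{R}^{d_\theta}$ is an unknown random parameter, constant in time, with known distribution; $x_0\in\mathbb{R}^{d_x}$ in the expectations is a random initial state whose monomials all have finite expectation. Polytopic dynamics: there are a positive integer $K$, continuous $h_k:\mathbb{S}_\theta\to[0,1]$ with $\sum_{k=1}^Kh_k(\theta)=1$, and locally Lipschitz $f_k:\mathbb{R}^{d_x}\to\mathbb{R}^{d_x}$ with $f_k(0)=0$ and $G_k:\mathbb{R}^{d_x}\to\mathbb{R}^{d_x\times d_u}$, with $f(x,\theta)=\sum_kh_k(\theta)f_k(x)$, $G(x,\theta)=\sum_kh_k(\theta)G_k(x)$. Controller and approximate cost. $\hat u(x,w):=\Phi(x)^\top w$,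 $w\in\mathbb{R}^{d_w}$, with $\Phi:\mathbb{R}^{d_x}\to\mathbb{R}^{d_w\times d_u}$ locally Lipschitz; $\hat J(x,\tilde v):=\phi(x)^\top\tilde v$ with $\phi:\mathbb{R}^{d_x}\to\mathbb{R}^{d_v}$ of class $C^1$, $\phi(0)=0$. $q:\mathbb{R}^{d_x}\to\mathbb{R}$ is continuous and globally positive definite ($q(0)=0$, $q(x)>0$ for $x\ne0$, $\lim_{\|x\|\to\infty}q(x)\neq0$), $R:\mathbb{R}^{d_x}\to\mathbb{R}^{d_u\times d_u}$ continuous with symmetric positive definite values, and $$B(x,\tilde v,w,\theta):=q(x)+\tfrac12\hat u(x,w)^\top R(x)\hat u(x,w)+\frac{\partial\hat J(x,\tilde v)}{\partial x}^\top\big(f(x,\theta)+G(x,\theta)\hat u(x,w)\big).$$ $v(w,\theta)\in\arg\min_{\tilde v\in\mathbb{R}^{d_v}}\big(\int_{\mathbb{R}^{d_x}}\mathcal{P}(x)B(x,\tilde v,w,\theta)^2dx+\eta\|\tilde v\|^2\big)$, where $\eta\ge0$ is a constant and $\mathcal{P}:\mathbb{R}^{d_x}\to[0,\infty]$ is a predefined weight function such that $\pi\mapsto\int\mathcal{P}\pi\,dx$ is linear, bounded and well-defined on continuous functions. Monomial bases. A function of $x\in\mathbb{R}^{d_x}$ (vector or matrix valued) is a monomial basis if each component is a primitive monomial $\prod_{i=1}^{d_x}[x]_i^{[a]_i}$ with $a\in\{0,1,2,\dots\}^{d_x}$. It is strict if it vanishes exactly at $x=0$. The non-redundant form of a monomial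 basis is a monomial basis whose components consist of those of the original one and are pairwise distinct monomials. Let $z:\mathbb{R}^{d_x}\to\mathbb{R}^{d_z}$ and $\zeta:\mathbb{R}^{d_x}\to\mathbb{R}^{d_\zeta}$ be monomial bases with $z$ strict and $[\zeta(x)]_1=1$; let $\xi:\mathbb{R}^{d_x}\to\mathbb{R}^{d_\xi}$ be the non-redundant form of $\zeta(x)\otimes z(x)$; let $Z:\mathbb{R}^{d_x}\to\mathbb{R}^{d_u\times d_Z}$ be continuous with $G_k(x)Z(x)$ polynomial for each $k$. SOS settings. (i) For each $k$ there is a known polynomial matrix $F_k:\mathbb{R}^{d_x}\to\mathbb{R}^{d_x\times d_z}$ with $f_k(x)=F_k(x)z(x)$. (ii) $\Phi(x)=z(x)\otimes Z(x)^\top$ (so $d_w=d_zd_Z$). (iii) For any $P\in\mathbb{R}^{d_z\times d_z}$, $w\in\mathbb{R}^{d_w}$ and $k$, each component of $$U_k(x,P,w):=-\frac{P+P^\top}{2}\,\frac{\partial z(x)}{\partial x^\top}\Big(F_k(x)+G_k(x)Z(x)\,\mathrm{vec}^{-1}_{d_Z,d_z}(w)\Big)$$ is a linear combination (constant coefficients) of the components of $\zeta(x)\otimes\zeta(x)$, where $\mathrm{vec}^{-1}_{d_Z,d_z}(w)\in\mathbb{R}^{d_Z\times d_z}$ is the matrix whose vectorization is $w$. (iv) There exist a symmetric $P\succ0$ and $w\in\mathbb{R}^{d_w}$ such that for every $k$ there is a symmetric $\bar S_k\succ0$ with $U_k(x,P,w)+U_k(x,P,w)^\top=(\zeta(x)\otimes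 I_{d_z})^\top\bar S_k(\zeta(x)\otimes I_{d_z})$ for all $x$. The matrices $T_k$. Write $r=[r_1,\dots,r_K]$ with $r_k\in\mathbb{R}^{d_r}$. For fixed suitable constants $C_r\in\mathbb{R}^{d_r\times d_\xi(d_\xi+1)/2}$ and $c_r\in\{0,1\}$ (chosen so that the following system has a unique solution for every $k$ and every $(w,P,r)$; such constants exist), $T_k(w,P,r)\in\mathbb{R}^{d_\xi\times d_\xi}$ is the unique $T_k$ satisfying $$\xi(x)^\top T_k\,\xi(x)=z(x)^\top U_k(x,P,w)z(x)\ \ \forall x\in\mathbb{R}^{d_x},\qquad C_r\,\mathrm{vech}(T_k)=c_rr_k,\qquad T_k=T_k^\top.$$ Penalty and objective. With constants $\kappa>0$ and $\rho_{\mathrm{ub}}\in\mathbb{R}$, $$\rho(w,P,r):=-\kappa\ln\Big(\det\big((P+P^\top)/2\big)\prod_{k=1}^K\det T_k(w,P,r)\Big)$$ if $P+P^\top\succ0$ and $T_k(w,P,r)\succ0$ for all $k$, and $\rho(w,P,r):=\rho_{\mathrm{ub}}$ otherwise. The objective is $g(w,P,r):=\mathrm{E}_\theta\big[\mathrm{E}_{x_0}[\hat J(x_0,v(w,\theta))]\big]+\rho(w,P,r)$. *)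

(* Defs.v *)
From HB Require Import structures.
From mathcomp Require Import all_boot all_order all_algebra.
From mathcomp Require Import mathcomp_extra boolp classical_sets functions.
From mathcomp Require Import cardinality reals ereal topology normedtype.
From mathcomp Require Import sequences exp derive measure lebesgue_measure.
From mathcomp Require Import lebesgue_integral probability.
From mathcomp.real_closed Require Import mxtens.

Set Implicit Arguments.
Unset Strict Implicit.
Unset Printing Implicit Defensive.

Import Order.TTheory GRing.Theory Num.Theory numFieldNormedType.Exports.

Local Open Scope classical_set_scope.
Local Open Scope ring_scope.

Definition posdefmx (R : realType) n (A : 'M[R]_n) : Prop :=
  A^T = A /\ forall v : 'cV[R]_n, v != 0 -> 0 < (v^T *m A *m v) 0 0.

(* Kronecker product whose left factor is a column vector; the cast turns the
   column count [1 * q] into [q]. *)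
Definition kron (R : realType) m p q (a : 'cV[R]_m) (B : 'M[R]_(p, q)) :
    'M[R]_(m * p, q) :=
  castmx (erefl, mul1n q) (tensmx a B).

(* Column stacking: entry (i, j) of a p x m matrix is component j * p + i of
   its vectorization. *)
Definition vec (R : realType) p m (A : 'M[R]_(p, m)) : 'cV[R]_(m * p) :=
  \col_k A (mxtens_unindex k).2 (mxtens_unindex k).1.

Definition unvec (R : realType) p m (w : 'cV[R]_(m * p)) : 'M[R]_(p, m) :=
  \matrix_(i, j) w (mxtens_index (j, i)) 0.

Lemma vecK (R : realType) p m : cancel (@vec R p m) (@unvec R p m).
Proof. by move=> A; apply/matrixP => i j; rewrite !mxE mxtens_indexK. Qed.

Lemma unvecK (R : realType) p m : cancel (@unvec R p m) (@vec R p m).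
Proof.
move=> w; apply/colP => k; rewrite !mxE -[in RHS](mxtens_unindexK k).
by case: (mxtens_unindex k).
Qed.

Definition vech_seq (R : realType) n (A : 'M[R]_n) : seq R :=
  [seq A i j | j <- enum 'I_n, i <- [seq i : 'I_n <- enum 'I_n | (j <= i)%N]].

(* The default value 0 of [nth] is never reached, see [size_vech_seq]. *)
Definition vech (R : realType) n (A : 'M[R]_n) : 'cV[R]_((n * n.+1)./2) :=
  \col_k nth 0 (vech_seq A) k.

Lemma size_vech_seq (R : realType) n (A : 'M[R]_n) :
  size (vech_seq A) = (n * n.+1)./2.
Proof.
rewrite /vech_seq size_allpairs_dep sumnE big_map big_enum /=.
transitivity (\sum_(j < n) (n - j))%N.
  apply: eq_bigr => j _.
  rewrite size_filter -(count_map val (leq j)) val_enum_ord.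
  have: (j <= n)%N := ltnW (ltn_ord j).
  move: (nat_of_ord j) => k kn.
  rewrite -{1}(subnKC kn) iotaD count_cat add0n.
  rewrite (@eq_in_count _ _ pred0) ?count_pred0; last first.
    by move=> i; rewrite mem_iota /= => ik; apply/negbTE; rewrite -ltnNge.
  rewrite (@eq_in_count _ _ predT) ?count_predT ?size_iota //.
  by move=> i; rewrite mem_iota /= => /andP[].
rewrite (reindex_inj rev_ord_inj) /=.
under eq_bigr => i _ do rewrite subKn //.
rewrite mulnC -(bin2 n.+1) -bin2_sum big_mkord big_ord_recl add0n.
by apply: eq_bigr.
Qed.

Definition grad (R : realType) m n (f : 'M[R]_(m, n) -> R) (X : 'M[R]_(m, n)) :
    'M[R]_(m, n) :=
  \matrix_(i, j) 'D_(delta_mx i j) f X.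

Definition jac (R : realType) n m (f : 'cV[R]_n -> 'cV[R]_m) (x : 'cV[R]_n) :
    'M[R]_(m, n) :=
  \matrix_(i, j) 'D_(delta_mx j 0) (fun y => f y i 0) x.

Definition C1 (R : realType) n m (f : 'cV[R]_n -> 'cV[R]_m) : Prop :=
  (forall x, differentiable f x) /\ continuous (jac f).

Definition locally_lipschitz (R : realType) (V W : normedModType R)
    (f : V -> W) : Prop :=
  forall x : V, exists2 U, nbhs x U & [lipschitz f y | y in U].

Definition is_solution (R : realType) n (F : 'cV[R]_n -> 'cV[R]_n)
    (x0 : 'cV[R]_n) (x : R -> 'cV[R]_n) : Prop :=
  [/\ x 0 = x0,
      {within [set t | 0 <= t], continuous x} &
      forall t : R, 0 < t -> is_derive t 1 x (F (x t))].

(* The limit presupposes that the trajectory exists on [0, +oo[, so global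
   existence is part of the property. *)
Definition robustly_GAS (R : realType) n p (S : set 'cV[R]_p)
    (F : 'cV[R]_n -> 'cV[R]_p -> 'cV[R]_n) : Prop :=
  forall theta, S theta -> forall x0 : 'cV[R]_n,
    (exists x, is_solution (F ^~ theta) x0 x) /\
    (forall x, is_solution (F ^~ theta) x0 x -> x t @[t --> +oo] --> (0 : 'cV[R]_n)).

Definition monomial (R : realType) n (a : 'I_n -> nat) (x : 'cV[R]_n) : R :=
  \prod_i x i 0 ^+ a i.

Definition monomial_basis (R : realType) n p q
    (y : 'cV[R]_n -> 'M[R]_(p, q)) : Prop :=
  forall i j, exists a, forall x, y x i j = monomial a x.

Definition strict_basis (R : realType) n p q
    (y : 'cV[R]_n -> 'M[R]_(p, q)) : Prop :=
  forall x, y x = 0 <-> x = 0.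

Definition nonredundant_form (R : realType) n p q
    (y' : 'cV[R]_n -> 'cV[R]_p) (y : 'cV[R]_n -> 'cV[R]_q) : Prop :=
  [/\ monomial_basis y',
      forall i, exists j, forall x, y' x i 0 = y x j 0,
      forall j, exists i, forall x, y' x i 0 = y x j 0 &
      injective (fun i x => y' x i 0)].

Definition polynomial_fun (R : realType) n (f : 'cV[R]_n -> R) : Prop :=
  exists s : seq (R * ('I_n -> nat)),
    forall x, f x = \sum_(t <- s) t.1 * monomial t.2 x.

Definition polynomial_mx (R : realType) n p q
    (F : 'cV[R]_n -> 'M[R]_(p, q)) : Prop :=
  forall i j, polynomial_fun (fun x => F x i j).

Section lebesgue_tuple.
Context {R : realType}.
Local Notation RT := (measurableTypeR R).

Definition tcons n (p : RT * n.-tuple RT) : n.+1.-tuple RT :=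
  [the n.+1.-tuple RT of p.1 :: p.2].

Lemma measurable_tcons n : measurable_fun setT (@tcons n).
Proof. exact: (measurable_cons measurable_fst measurable_snd). Qed.

Section cons.
Context n (mu : {sigma_finite_measure set (n.-tuple RT) -> \bar R}).

Definition lebesgue_cons : set (n.+1.-tuple RT) -> \bar R :=
  pushforward (product_measure1 (@lebesgue_measure R) mu) (@tcons n).

Let lebesgue_cons_measure : {measure set (n.+1.-tuple RT) -> \bar R} :=
  measure_function_pushforward__canonical__measure_function_Measure
    (product_measure1 (@lebesgue_measure R) mu) (@measurable_tcons n).

HB.instance Definition _ := isMeasure.Build _ _ _ lebesgue_cons
  (measure0 lebesgue_cons_measure) (measure_ge0 lebesgue_cons_measure)
  (@measure_semi_sigma_additive _ _ _ lebesgue_cons_measure).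

Let lebesgue_cons_sigma_finite : sigma_finite setT lebesgue_cons.
Proof.
have /sigma_finiteP[F [FT ndF Foo]] := sigma_finiteT (@lebesgue_measure R).
have /sigma_finiteP[G [GT ndG Goo]] := sigma_finiteT mu.
exists (fun i => (fun t : n.+1.-tuple RT => thead t) @^-1` F i `&`
                 (fun t : n.+1.-tuple RT => [tuple of behead t]) @^-1` G i).
  apply/seteqP; split=> t // _.
  have [k _ Fk] : (\bigcup_i F i) (thead t) by rewrite -FT.
  have [l _ Gl] : (\bigcup_i G i) [tuple of behead t] by rewrite -GT.
  exists (maxn k l) => //; split => /=.
    by move: Fk; exact/subsetPset/ndF/leq_maxl.
  by move: Gl; exact/subsetPset/ndG/leq_maxr.
move=> i; have [mF Fi] := Foo i; have [mG Gi] := Goo i; split.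
  apply: measurableI; rewrite -[X in measurable X]setTI.
    exact: (measurable_tnth ord0).
  exact: measurable_behead.
rewrite /lebesgue_cons /pushforward (_ : _ @^-1` _ = F i `*` G i).
  by rewrite product_measure1E// lte_mul_pinfty// ge0_fin_numE.
have hE p : thead (@tcons n p) = p.1 by [].
have tE p : [tuple of behead (@tcons n p)] = p.2 by exact: val_inj.
by apply/seteqP; split=> p /=; rewrite hE tE.
Qed.

HB.instance Definition _ := Measure_isSigmaFinite.Build _ _ _ lebesgue_cons
  lebesgue_cons_sigma_finite.

End cons.

Fixpoint lebesgue_tuple n : {sigma_finite_measure set (n.-tuple RT) -> \bar R} :=
  if n is n'.+1 then lebesgue_cons (lebesgue_tuple n') else \d_[tuple].

End lebesgue_tuple.

(* The components of a column vector of R^n are the entries of a tuple. *)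
Definition lebesgue_int (R : realType) n (F : 'cV[R]_n -> \bar R) : \bar R :=
  \int[lebesgue_tuple n]_(t in [set: n.-tuple (measurableTypeR R)])
    F (\col_i tnth t i).

(* [p x] may be +oo; it is the density of the functional
   pi |-> lebesgue_int (p * pi), required to be finite (well defined), linear
   and bounded, the latter with respect to the topology of uniform convergence
   on compact sets. *)
Record admissible_weight (R : realType) n (p : 'cV[R]_n -> \bar R) : Prop := {
  weight_ge0 : forall x, (0 <= p x)%E;
  weight_integrable : forall f : 'cV[R]_n -> R, continuous f ->
    (@lebesgue_tuple R n).-integrable setT
      (fun t => p (\col_i tnth t i) * (f (\col_i tnth t i))%:E)%E;
  weight_linear : forall (a : R) (f1 f2 : 'cV[R]_n -> R),
    continuous f1 -> continuous f2 ->
    lebesgue_int (fun x => p x * (a * f1 x + f2 x)%:E)%E =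
    (a%:E * lebesgue_int (fun x => p x * (f1 x)%:E)
     + lebesgue_int (fun x => p x * (f2 x)%:E))%E;
  weight_bounded : exists (C : set 'cV[R]_n) (M : R), compact C /\
    forall (f : 'cV[R]_n -> R) (c : R), continuous f -> 0 <= c ->
      (forall x, C x -> `|f x| <= c) ->
      (`|lebesgue_int (fun x => p x * (f x)%:E)%E| <= (M * c)%:E)%E
}.

(* The last clause reads lim_{|x| -> oo} q(x) <> 0: q does not tend to 0. *)
Definition globally_posdef (R : realType) n (q : 'cV[R]_n -> R) : Prop :=
  [/\ q 0 = 0, forall x, x != 0 -> 0 < q x &
      ~ (forall e : R, 0 < e ->
           exists M : R, forall x, M < `|x| -> `|q x| < e)].

Definition polytopic (R : realType) n p K (V : lmodType R)
    (h : 'I_K -> 'cV[R]_p -> R) (a : 'I_K -> 'cV[R]_n -> V)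
    (x : 'cV[R]_n) (theta : 'cV[R]_p) : V :=
  \sum_k h k theta *: a k x.

Definition uhat (R : realType) n dw du (Phi : 'cV[R]_n -> 'M[R]_(dw, du))
    (x : 'cV[R]_n) (w : 'cV[R]_dw) : 'cV[R]_du :=
  (Phi x)^T *m w.

Definition Jhat (R : realType) n dv (phi : 'cV[R]_n -> 'cV[R]_dv)
    (x : 'cV[R]_n) (v : 'cV[R]_dv) : R :=
  ((phi x)^T *m v) 0 0.

Definition closed_loop (R : realType) n p du dw
    (f : 'cV[R]_n -> 'cV[R]_p -> 'cV[R]_n)
    (G : 'cV[R]_n -> 'cV[R]_p -> 'M[R]_(n, du))
    (Phi : 'cV[R]_n -> 'M[R]_(dw, du)) (w : 'cV[R]_dw)
    (x : 'cV[R]_n) (theta : 'cV[R]_p) : 'cV[R]_n :=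
  f x theta + G x theta *m uhat Phi x w.

Definition bellman (R : realType) n p du dw dv
    (f : 'cV[R]_n -> 'cV[R]_p -> 'cV[R]_n)
    (G : 'cV[R]_n -> 'cV[R]_p -> 'M[R]_(n, du))
    (Phi : 'cV[R]_n -> 'M[R]_(dw, du)) (phi : 'cV[R]_n -> 'cV[R]_dv)
    (q : 'cV[R]_n -> R) (Rm : 'cV[R]_n -> 'M[R]_du)
    (x : 'cV[R]_n) (v : 'cV[R]_dv) (w : 'cV[R]_dw) (theta : 'cV[R]_p) : R :=
  q x + 2^-1 * ((uhat Phi x w)^T *m Rm x *m uhat Phi x w) 0 0
  + ((grad (fun y => Jhat phi y v) x)^T *m closed_loop f G Phi w x theta) 0 0.

(* The norm of the library on matrices is the sup norm, hence the explicit
   Euclidean square [v^T v]. *)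
Definition bellman_residual (R : realType) n dv (p : 'cV[R]_n -> \bar R)
    (eta : R) (B : 'cV[R]_n -> 'cV[R]_dv -> R) (v : 'cV[R]_dv) : \bar R :=
  (lebesgue_int (fun x => p x * (B x v ^+ 2)%:E)
   + (eta * (v^T *m v) 0 0)%:E)%E.

Definition argmin (R : realType) (T : Type) (c : T -> \bar R) : set T :=
  [set v | forall v', (c v <= c v')%E].

Definition random_vector (R : realType) d (Omega : measurableType d) n
    (X : Omega -> 'cV[R]_n) : Prop :=
  forall i, measurable_fun setT (fun o => X o i 0).

(* The initial state and the parameter are drawn independently: the inner
   expectation is over x0 alone. *)
Definition expected_cost (R : realType) n p dv dw
    d1 (Omega1 : measurableType d1) (P1 : probability Omega1 R)
    d2 (Omega2 : measurableType d2) (P2 : probability Omega2 R)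
    (theta : Omega1 -> 'cV[R]_p) (x0 : Omega2 -> 'cV[R]_n)
    (phi : 'cV[R]_n -> 'cV[R]_dv) (v : 'cV[R]_dw -> 'cV[R]_p -> 'cV[R]_dv)
    (w : 'cV[R]_dw) : R :=
  fine 'E_P1[fun o1 =>
    fine 'E_P2[fun o2 => Jhat phi (x0 o2) (v w (theta o1))]].

Definition Umx (R : realType) n du dz dZ (z : 'cV[R]_n -> 'cV[R]_dz)
    (F : 'cV[R]_n -> 'M[R]_(n, dz)) (G : 'cV[R]_n -> 'M[R]_(n, du))
    (Z : 'cV[R]_n -> 'M[R]_(du, dZ))
    (x : 'cV[R]_n) (P : 'M[R]_dz) (w : 'cV[R]_(dz * dZ)) : 'M[R]_dz :=
  - ((2^-1 *: (P + P^T)) *m jac z x *m (F x + G x *m Z x *m unvec w)).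

Definition Tmx_system (R : realType) n dz dxi dr
    (z : 'cV[R]_n -> 'cV[R]_dz) (xi : 'cV[R]_n -> 'cV[R]_dxi)
    (U : 'cV[R]_n -> 'M[R]_dz)
    (Cr : 'M[R]_(dr, (dxi * dxi.+1)./2)) (cr : R) (rk : 'cV[R]_dr)
    (T : 'M[R]_dxi) : Prop :=
  [/\ forall x, (xi x)^T *m T *m xi x = (z x)^T *m U x *m z x,
      Cr *m vech T = cr *: rk &
      T = T^T].

Definition penalty (R : realType) K dz dxi (kappa rho_ub : R)
    (P : 'M[R]_dz) (T : 'I_K -> 'M[R]_dxi) : R :=
  if `[< posdefmx (P + P^T) /\ forall k, posdefmx (T k) >]
  then - kappa * ln (\det (2^-1 *: (P + P^T)) * \prod_k \det (T k))
  else rho_ub.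

(* Main.v *)
Require Import Defs.
From HB Require Import structures.
From mathcomp Require Import all_boot all_order all_algebra.
From mathcomp Require Import mathcomp_extra boolp classical_sets functions.
From mathcomp Require Import cardinality reals ereal topology normedtype.
From mathcomp Require Import sequences exp derive measure lebesgue_measure.
From mathcomp Require Import lebesgue_integral probability.
From mathcomp.real_closed Require Import mxtens.
From mathcomp Require Import realfun ftc lra ring.

(** The gradient iteration enters only through its outcome. If the cost is at
least [Jlb] while the objective has not increased, then the penalty is smaller
than [rho_ub]; as the penalty equals [rho_ub] at infeasible points, [P + P^T]
and all the [T_k] are positive definite ([penalty_lt_feasible]).

Put [V(x) = z(x)^T P' z(x)] with [P' = (P + P^T) / 2]. The controller is
[Z(x) W z(x)] with [W] the matrix whose vectorization is [w] ([kron_mul_unvec]),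
so the closed loop is a convex combination of the vertex fields
[(F_k + G_k Z W) z], and along it the derivative of [V] is
[- 2 \sum_k h_k z^T U_k z = - 2 \sum_k h_k xi^T T_k xi] ([Umx_quadform]).
Positive definite forms are bounded below by a multiple of the squared norm
([posdefmx_coercive]), and [|z| <= |xi|] ([nonredundant_form_norm_le]); thus the
derivative is at most [- c V] for some [c > 0]. A strict monomial basis contains
a pure power of every variable ([strict_basis_coercive]), so [V] is proper and
[x] is small as soon as [V(x)] is small.

What remains is a Lyapunov theorem for autonomous locally Lipschitz fields
([lyapunov_GAS]), in which the global existence of trajectories is part of the
conclusion. It is obtained by multiplying the field by a cutoff factor that is 1
on the relevant sublevel set: the new field is globally Lipschitz
([cutoff_lipschitz]), has global solutions by Picard iteration
([global_solution]), and still does not increase [V], so its solution never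
leaves the region where the two fields agree. *)

Set Implicit Arguments.
Unset Strict Implicit.
Unset Printing Implicit Defensive.

Import Order.TTheory GRing.Theory Num.Theory numFieldNormedType.Exports.

Local Open Scope classical_set_scope.
Local Open Scope ring_scope.

(** * Scalar primitives and derivative comparison *)

Section ScalarCalculus.
Context {R : realType}.

(** The primitive is the Lebesgue integral started at -1, so that 0 is interior
to the domain where the fundamental theorem applies; freezing it on the negative
half-line makes it continuous everywhere. *)
Lemma primitive_exists (g : R -> R) : continuous g ->
  exists G : R -> R, [/\ continuous G, G 0 = 0 &
    forall t : R, 0 < t -> is_derive t (1:R) G (g t)].
Proof.
move=> gc.
pose F (x : R) : R := (\int[lebesgue_measure]_(t in `[-1, x]) g t)%R.
have dF (x : R) : -1 < x -> is_derive x (1:R) F (g x).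
  move=> x1; have xu : x < x + 1 by rewrite ltrDl.
  have gi : lebesgue_measure.-integrable `[-1, x + 1] (EFin \o g).
    apply: continuous_compact_integrable; first exact: segment_compact.
    exact: continuous_subspaceT.
  have [dF1 dF2] := continuous_FTC1_closed xu gi x1 (gc x).
  by apply: DeriveDef; [exact: dF1|rewrite -derive1E; exact: dF2].
have cF (x : R) : -1 < x -> {for x, continuous F}.
  move=> /dF dFx; apply/differentiable_continuous/derivable1_diffP.
  exact: ex_derive.
exists (fun t => F (Num.max 0 t) - F 0); split.
- move=> t; apply: cvgB; last exact: cvg_cst.
  have c1 : {for t, continuous (fun t : R => Num.max 0 t)}.
    by apply: (@continuous_max _ _ (cst 0) id); [exact: cvg_cst|exact: cvg_id].
  have c2 : {for Num.max 0 t, continuous F}.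
    by apply: cF; rewrite lt_max; apply/orP; left; lra.
  exact: (continuous_comp c1 c2).
- by rewrite maxxx subrr.
- move=> t t0; apply: (@near_eq_is_derive _ _ _ (F - cst (F 0))).
    near=> s; rewrite -![(_ - _ : R -> R) _]/(_ - _).
    rewrite max_r//; near: s; exact: lt_le_nbhsr.
  have t1 : -1 < t by lra.
  have ? := dF _ t1.
  by rewrite -[g t]subr0; apply: is_deriveB.
Unshelve. all: by end_near. Qed.

Lemma nonincreasing_of_derive_le0 (f df : R -> R) :
  {within [set t | 0 <= t], continuous f} ->
  (forall t : R, 0 < t -> is_derive t (1:R) f (df t)) ->
  (forall t, 0 < t -> df t <= 0) ->
  forall t, 0 <= t -> f t <= f 0.
Proof.
move=> cf fd df0 t t0.
apply: (@ler0_derive1_nincry _ f 0) => //.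
- by move=> x; rewrite in_itv/= andbT => /fd [].
- move=> x; rewrite in_itv/= andbT => x0.
  by have [_ dfE] := fd _ x0; rewrite derive1E dfE df0.
- have -> // : [set` `[0, +oo[] = [set t : R | 0 <= t].
  by apply/seteqP; split => x /=; rewrite in_itv/= andbT.
Qed.

(** A mean value inequality without integrals: [f - g] and [- f - g] both have a
nonpositive derivative. *)
Lemma abs_le_of_derive_le (f df g dg : R -> R) :
  continuous f -> continuous g ->
  (forall t : R, 0 < t -> is_derive t (1:R) f (df t)) ->
  (forall t : R, 0 < t -> is_derive t (1:R) g (dg t)) ->
  (forall t, 0 < t -> `|df t| <= dg t) -> `|f 0| <= g 0 ->
  forall t, 0 <= t -> `|f t| <= g t.
Proof.
move=> cf cg fd gd dfg fg0 t t0.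
move: fg0; rewrite !ler_norml => /andP[fg1 fg2].
have H1 : (f - g) t <= (f - g) 0.
  apply: (@nonincreasing_of_derive_le0 (f - g) (df - dg)) => //.
  - apply: continuous_subspaceT => x; exact: cvgB (cf x) (cg x).
  - by move=> s s0; have ? := fd s s0; have ? := gd s s0; apply: is_deriveB.
  - by move=> s /dfg; rewrite ler_norml subr_le0 => /andP[].
have H2 : (- f - g) t <= (- f - g) 0.
  apply: (@nonincreasing_of_derive_le0 (- f - g) (- df - dg)) => //.
  - apply: continuous_subspaceT => x; apply: cvgB; [exact: cvgN (cf x)|exact: cg x].
  - by move=> s s0; have ? := fd s s0; have ? := gd s s0; apply: is_deriveB.
  - move=> s /dfg; rewrite ler_norml lerNl subr_le0 => /andP[]//.
move: H1 H2; rewrite -![(_ - _ : R -> R) _]/(_ - _) -![(- _ : R -> R) _]/(- _).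
by move=> H1 H2; apply/andP; split; lra.
Qed.

End ScalarCalculus.

(** * Curves of column vectors *)

Section VectorCalculus.
Context {R : realType}.

Lemma mx_entry_norm_le m n (A : 'M[R]_(m, n)) i j : `|A i j| <= `|A|.
Proof.
rewrite [leRHS]/Num.Def.normr/= mx_normrE.
exact: (le_bigmax _ (fun ij => `|A ij.1 ij.2|) (i, j)).
Qed.

Lemma mx_norm_leP n (v : 'cV[R]_n) (c : R) : 0 <= c ->
  (`|v| <= c) <-> (forall i, `|v i 0| <= c).
Proof.
move=> c0; rewrite /Num.Def.normr/= mx_normrE; split.
- move=> /bigmax_leP[_ /=] H i; exact: (H (i, ord0) isT).
- move=> H; apply/bigmax_leP; split => // ij _; rewrite (ord1 ij.2); exact: H.
Qed.

Lemma cvg_col T (F : set_system T) {FF : Filter F} n (f : T -> 'cV[R]_n) (l : 'cV[R]_n) :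
  (forall i, f x i 0 @[x --> F] --> l i 0) -> f x @[x --> F] --> l.
Proof.
move=> fl; apply/cvgrPdist_le => e e0.
have H i : \forall x \near F, `|l i 0 - f x i 0| <= e.
  by have /cvgrPdist_le := fl i; exact.
have := filter_forall FF H; apply: filterS => x /= Hx.
apply/mx_norm_leP; [exact: ltW|move=> i].
by rewrite !mxE.
Qed.

Lemma continuous_col (T : topologicalType) n (f : T -> 'cV[R]_n) :
  (forall i, continuous (fun x => f x i 0)) -> continuous f.
Proof. by move=> cf x; apply: cvg_col => i; exact: cf. Qed.

Lemma is_derive_col n (f : R -> 'cV[R]_n) (t : R) (df : 'cV[R]_n) :
  (forall i, is_derive t (1:R) (fun s => f s i 0) (df i 0)) <->
  is_derive t (1:R) f df.
Proof.
split.
- move=> H; have fd : derivable f t 1.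
    by apply/derivable_mxP => i j; rewrite ord1; have [] := H i.
  apply: DeriveDef => //; rewrite derive_mx//; apply/colP => i; rewrite mxE.
  by have [] := H i.
- move=> [fd <-] i; rewrite derive_mx// mxE; apply: DeriveDef => //.
  by have /derivable_mxP/(_ i 0) := fd.
Qed.

Lemma primitive_col n (u : R -> 'cV[R]_n) (x0 : 'cV[R]_n) : continuous u ->
  exists x : R -> 'cV[R]_n, [/\ continuous x, x 0 = x0 &
    forall t : R, 0 < t -> is_derive t (1:R) x (u t)].
Proof.
move=> cu.
have /choice[G HG] i : exists G : R -> R, [/\ continuous G, G 0 = 0 &
    forall t : R, 0 < t -> is_derive t (1:R) G (u t i 0)].
  apply: primitive_exists => t.
  apply: (@continuous_comp _ _ _ u (fun M : 'cV[R]_n => M i 0)); first exact: cu.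
  exact: coord_continuous.
exists (fun t => \col_i (x0 i 0 + G i t)); split.
- apply: continuous_col => i; have [cG _ _] := HG i.
  have -> : (fun t => (\col_i0 (x0 i0 0 + G i0 t)) i 0 : R) = (fun t => x0 i 0 + G i t).
    by apply/funext => t; rewrite mxE.
  by move=> t; apply: cvgD; [exact: cvg_cst|exact: cG].
- by apply/colP => i; rewrite mxE; have [_ -> _] := HG i; rewrite addr0.
- move=> t t0; apply/is_derive_col => i; have [_ _ /(_ t t0) dG] := HG i.
  have -> : (fun t => (\col_i0 (x0 i0 0 + G i0 t)) i 0 : R) = cst (x0 i 0) + G i.
    by apply/funext => s; rewrite mxE.
  by rewrite -[u t i 0]add0r; apply: is_deriveD.
Qed.

Lemma norm_le_of_derive_le n (f df : R -> 'cV[R]_n) (g dg : R -> R) :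
  continuous f -> continuous g ->
  (forall t : R, 0 < t -> is_derive t (1:R) f (df t)) ->
  (forall t : R, 0 < t -> is_derive t (1:R) g (dg t)) ->
  (forall t, 0 < t -> `|df t| <= dg t) -> `|f 0| <= g 0 ->
  forall t, 0 <= t -> `|f t| <= g t.
Proof.
move=> cf cg fd gd dfg fg0 t t0.
have H i s : 0 <= s -> `|f s i 0| <= g s.
  move=> s0.
  apply: (@abs_le_of_derive_le R (fun s => f s i 0) (fun s => df s i 0) g dg) => //.
  - move=> ?; apply: (@continuous_comp _ _ _ f (fun M : 'cV[R]_n => M i 0)).
      exact: cf.
    exact: coord_continuous.
  - by move=> ? /fd /is_derive_col.
  - by move=> ? /dfg; apply: le_trans; exact: mx_entry_norm_le.
  - by apply: le_trans fg0; exact: mx_entry_norm_le.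
(* In dimension 0 no coordinate of [f] yields the sign of [g t]. *)
have g0 : 0 <= g t.
  rewrite -(normr0 R); apply: (@abs_le_of_derive_le R (cst 0) (cst 0) g dg) => //.
  - by move=> ?; exact: cvg_cst.
  - by move=> s /dfg; apply: le_trans; rewrite normr0.
  - by apply: le_trans fg0; rewrite normr0.
by apply/mx_norm_leP => // i; exact: H.
Qed.

End VectorCalculus.

(** * Global solutions of Lipschitz differential equations *)

Section Picard.
Context {R : realType}.

Lemma lipschitz_continuous (V W : normedModType R) (f : V -> W) (L : R) :
  (forall x y, `|f x - f y| <= L * `|x - y|) -> continuous f.
Proof.
move=> fL x; apply/cvgrPdist_le => e e0.
have L0 : 0 < `|L| + 1 by rewrite ltr_wpDl.
near=> y; apply: le_trans (fL _ _) _.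
apply: (@le_trans _ _ ((`|L| + 1) * `|x - y|)).
  by rewrite ler_wpM2r// (le_trans (ler_norm L))// lerDl.
rewrite mulrC -ler_pdivlMr// ltW//; near: y.
by apply/nbhs_normP; exists (e / (`|L| + 1)) => //=; rewrite divr_gt0.
Unshelve. all: by end_near. Qed.

Lemma is_derive_scaled_exp (c a t : R) :
  is_derive t (1:R) (fun s => c * expR (a * s)) (a * (c * expR (a * t))).
Proof.
have H1 : is_derive t (1:R) ( *%R a) a.
  have -> : *%R a = a *: (id : R -> R) by [].
  by apply: is_derive_eq; rewrite /GRing.scale/= mulr1.
have H2 : is_derive t (1:R) (expR \o *%R a) (a * expR (a * t)).
  by have := is_derive1_comp (is_derive_expR (a * t)) H1; rewrite mulrC.
have -> : (fun s => c * expR (a * s)) = c *: (expR \o *%R a) by [].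
by apply: is_derive_eq; rewrite /GRing.scale/= mulrCA.
Qed.

(** Picard iteration on the whole half-line at once: measured against the weight
[exp (2 L t)], integration of an [L]-Lipschitz field halves distances, so
consecutive iterates are at weighted distance at most [|F x0| / 2 ^ k]. The
estimates come from derivative bounds instead of integrals. *)
Lemma global_solution n (F : 'cV[R]_n -> 'cV[R]_n) (L : R) (x0 : 'cV[R]_n) :
  (forall x y, `|F x - F y| <= L * `|x - y|) ->
  exists x, is_solution F x0 x.
Proof.
(* [1 <= L] makes the first step fit the weight, as then
   [|F x0| <= 2 L |F x0| exp (2 L t)]. *)
wlog L1 : L / 1 <= L => [hw FL|FL].
  have L1 : 1 <= Num.max 1 L by rewrite le_max lexx.
  apply: (hw _ L1) => x y; apply: le_trans (FL x y) _.
  by rewrite ler_wpM2r// le_max lexx orbT.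
have L0 : 0 < L by lra.
have Fc : continuous F.
  exact: lipschitz_continuous FL.
(* [T u] is the primitive of [F \o u] that starts at [x0]. *)
have /choice[T HT] (u : R -> 'cV[R]_n) : exists x : R -> 'cV[R]_n,
    continuous u -> [/\ continuous x, x 0 = x0 &
      forall t : R, 0 < t -> is_derive t (1:R) x (F (u t))].
  have [cu|ncu] := pselect (continuous u); last by exists u => /ncu.
  have cFu : continuous (F \o u).
    by move=> t; apply: continuous_comp; [exact: cu|exact: Fc].
  by have [x Hx] := primitive_col x0 cFu; exists x.
pose X k := iter k T (cst x0).
have Xc k : continuous (X k).
  elim: k => [|k IH]; first by move=> ?; exact: cvg_cst.
  by have [] := HT _ IH.
have X0 k : X k 0 = x0 by case: k => [//|k]; have [] := HT _ (Xc k).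
have dX k (t : R) : 0 < t -> is_derive t (1:R) (X k.+1) (F (X k t)).
  by move=> t0; have [_ _] := HT _ (Xc k); exact.
pose D (c t : R) := c * expR (2 * L * t).
have D0 c t : 0 <= c -> 0 <= D c t.
  by move=> c0; rewrite mulr_ge0// expR_ge0.
have dD (c t : R) : is_derive t (1:R) (D c) (2 * L * D c t).
  exact: is_derive_scaled_exp.
have Dc c : continuous (D c).
  move=> t; apply/differentiable_continuous/derivable1_diffP.
  by apply: ex_derive; exact: dD.
pose C := `|F x0|.
(* Contraction in the weighted norm. *)
have step (u u' : R -> 'cV[R]_n) (c : R) : continuous u -> continuous u' ->
    (forall t : R, 0 <= t -> `|u t - u' t| <= D c t) ->
    forall t : R, 0 <= t -> `|T u t - T u' t| <= D (c / 2) t.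
  move=> cu cu' uu' t t0.
  have [cx x_0 dx] := HT _ cu.
  have [cy y_0 dy] := HT _ cu'.
  have uu'c : 0 <= c.
    have := uu' _ (lexx 0); rewrite /D mulr0 expR0 mulr1; exact: le_trans.
  rewrite -[T u t - T u' t]/((T u - T u') t).
  apply: (@norm_le_of_derive_le R n (T u - T u') (fun s => F (u s) - F (u' s))
    (D (c / 2)) (fun t => 2 * L * D (c / 2) t)) => //.
  - by move=> s; apply: cvgB; [exact: cx|exact: cy].
  - by move=> s s0; have ? := dx s s0; have ? := dy s s0; apply: is_deriveB.
  - move=> s s0; apply: le_trans (FL _ _) _.
    have -> : 2 * L * D (c / 2) s = L * D c s by rewrite /D; field.
    by rewrite ler_wpM2l// ?uu'// ltW.
  - rewrite -![(_ - _ : R -> _) _]/(_ - _) x_0 y_0 subrr normr0.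
    by apply: D0; rewrite divr_ge0.
have Xstep k t : 0 <= t -> `|X k.+1 t - X k t| <= D (C / 2 ^+ k) t.
  elim: k t => [|k IH] t t0; last first.
    have := step _ _ _ (Xc k.+1) (Xc k) IH t t0.
    by rewrite -mulrA -invfM -exprSr.
  rewrite expr0 divr1.
  rewrite -[X 1%N t - X 0%N t]/((X 1%N - X 0%N) t).
  apply: (@norm_le_of_derive_le R n (X 1%N - X 0%N) (F \o X 0%N)
    (D C) (fun t => 2 * L * D C t)) => //.
  - by move=> s; apply: cvgB; exact: Xc.
  - move=> s s0; rewrite -[(F \o X 0%N) s]subr0.
    exact: is_deriveB (dX 0%N s s0) (is_derive_cst x0 s 1).
  - move=> s s0; rewrite /= /X/= -/C.
    have : C <= D C s.
      rewrite ler_peMr ?normr_ge0// -expR0 ler_expR.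
      by rewrite !mulr_ge0//; lra.
    have := D0 C s (normr_ge0 _).
    nra.
  - by rewrite -![(_ - _ : R -> _) _]/(_ - _) !X0 subrr normr0 D0// normr_ge0.
have Xtail k m t : 0 <= t -> `|X (k + m)%N t - X k t| <= D (2 * C / 2 ^+ k) t.
  move=> t0; suff : `|X (k + m)%N t - X k t| <=
      D (2 * C / 2 ^+ k - 2 * C / 2 ^+ (k + m)) t.
    move=> /le_trans; apply; rewrite /D ler_wpM2r ?expR_ge0// lerBlDr lerDl.
    by rewrite divr_ge0 ?exprn_ge0// mulr_ge0// normr_ge0.
  elim: m => [|m IH]; first by rewrite addn0 !subrr normr0 D0.
  rewrite addnS -(subrKA (X (k + m)%N t)).
  apply: le_trans (ler_normD _ _) _.
  apply: le_trans (lerD (Xstep _ _ t0) IH) _.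
  rewrite /D -mulrDl ler_wpM2r ?expR_ge0// exprS.
  by rewrite le_eqVlt; apply/orP; left; apply/eqP; field; rewrite !expf_neq0.
have D_small c t : D (c / 2 ^+ k) t @[k --> \oo] --> 0.
  have -> : (fun k => D (c / 2 ^+ k) t) = geometric (D c t) 2^-1.
    by apply/funext => k; rewrite /= /D exprVn mulrAC.
  by apply: cvg_geometric; rewrite ger0_norm ?invf_lt1 ?ltr1n// invr_ge0.
have X_cvg t i : 0 <= t -> cvg (X k t i 0 @[k --> \oo]).
  move=> t0; apply/cauchy_cvgP/cauchy_exP => e e0.
  have /cvgrPdist_lt/(_ e e0)[k _ Hk] := D_small (2 * C) t.
  exists (X k t i 0); exists k => // m km.
  rewrite /ball/= -[m](subnKC km) distrC.
  have := mx_entry_norm_le (X (k + (m - k))%N t - X k t) i 0.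
  rewrite !mxE => /le_lt_trans; apply.
  apply: le_lt_trans (Xtail _ _ _ t0) _.
  have := Hk k (leqnn k); rewrite sub0r normrN ger0_norm//.
  by rewrite D0// divr_ge0 ?exprn_ge0// mulr_ge0// normr_ge0.
pose x (t : R) : 'cV[R]_n := \col_i lim (X k t i 0 @[k --> \oo]).
have xX k t : 0 <= t -> `|x t - X k t| <= D (2 * C / 2 ^+ k) t.
  move=> t0; apply/mx_norm_leP => [|i].
    by rewrite D0// divr_ge0 ?exprn_ge0// mulr_ge0// normr_ge0.
  have := X_cvg t i t0 => /cvg_ex[l Xl].
  rewrite !mxE (cvg_lim _ Xl)//.
  have Xkl : `|X j t i 0 - X k t i 0| @[j --> \oo] --> `|l - X k t i 0|.
    by apply: cvg_norm; apply: cvgB Xl _; exact: cvg_cst.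
  apply: (cvgr_to_le Xkl); exists k => // j kj /=.
  rewrite -[j](subnKC kj); apply: le_trans (Xtail k (j - k)%N t t0).
  by have := mx_entry_norm_le (X (k + (j - k))%N t - X k t) i 0; rewrite !mxE.
(* [T] acts on functions continuous on all of R, whereas the limit is only
   controlled on the half-line. *)
pose x' (t : R) := x (Num.max 0 t).
have xc : continuous x'.
  move=> t; apply/(@cvgrPdist_lt _ _ _ _ (nbhs_filter t)) => e e0.
  have e3 : 0 < e / 3 by rewrite divr_gt0.
  have [k _ Hk] := (cvgrPdist_lt _ _).1 (D_small (2 * C) (`|t| + 1)) _ e3.
  have {Hk} Dk : D (2 * C / 2 ^+ k) (`|t| + 1) < e / 3.
    have := Hk k (leqnn k); rewrite sub0r normrN ger0_norm//.
    by rewrite D0// divr_ge0 ?exprn_ge0// mulr_ge0// normr_ge0.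
  have Dmono s : s <= `|t| + 1 -> D (2 * C / 2 ^+ k) s < e / 3.
    move=> st; apply: le_lt_trans Dk; rewrite /D ler_wpM2l//.
      by rewrite divr_ge0 ?exprn_ge0// mulr_ge0// normr_ge0.
    by rewrite ler_expR ler_wpM2l// mulr_ge0// ltW.
  have Xmc : continuous (fun s : R => X k (Num.max 0 s)).
    move=> s; apply: (@continuous_comp _ _ _ (fun s : R => Num.max 0 s) (X k)).
      by apply: (@continuous_max _ _ (cst 0) id); [exact: cvg_cst|exact: cvg_id].
    exact: Xc.
  have := (@cvgrPdist_lt _ _ _ _ (nbhs_filter t) _ _).1 (Xmc t) _ e3.
  have : \forall s \near (t : R), `|t - s| < 1.
    exact: (nbhsx_ballx t 1 ltr01).
  apply: filterS2 => s ts Xts.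
  have mt0 (r : R) : 0 <= Num.max 0 r by rewrite le_max lexx.
  have mt : Num.max 0 t <= `|t| + 1.
    rewrite ge_max; have := ler_norm t; have := normr_ge0 t.
    by move=> *; apply/andP; split; lra.
  have ms : Num.max 0 s <= `|t| + 1.
    rewrite ge_max; have := ler_norm t; have := normr_ge0 t.
    by move: ts; rewrite ltr_norml => /andP[] *; apply/andP; split; lra.
  have H1 := le_lt_trans (xX k _ (mt0 t)) (Dmono _ mt).
  have H2 := le_lt_trans (xX k _ (mt0 s)) (Dmono _ ms).
  rewrite /x' -(subrKA (X k (Num.max 0 t))) -(subrKA (X k (Num.max 0 s)) (X k _)).
  apply: le_lt_trans (ler_normD _ _) _.
  have := ler_normD (X k (Num.max 0 t) - X k (Num.max 0 s))
    (X k (Num.max 0 s) - x (Num.max 0 s)).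
  rewrite [`|X k _ - x _|]distrC.
  move: H1 H2 Xts; set p1 := `| _ |; set p2 := `| _ |; set p3 := `|_|; set p4 := `|_|.
  lra.
have [yc y0 dy] := HT _ xc.
(* Both [T x'] and [x] are limits of the iterates, so [x] is a fixed point. *)
have yx t : 0 <= t -> T x' t = x t.
  move=> t0; apply/eqP; rewrite -subr_eq0 -normr_le0.
  have Dc2 : D (2 * C / 2 ^+ k.+1) t + D (2 * C / 2 ^+ k.+1) t @[k --> \oo] --> 0.
    have DS : D (2 * C / 2 ^+ k.+1) t @[k --> \oo] --> 0.
      by rewrite (cvg_shiftS (fun k => D (2 * C / 2 ^+ k) t)); exact: D_small.
    by rewrite -[0]addr0; exact: (cvgD DS DS).
  apply: (@ler_cvg_to _ _ _ _ (cst (`|T x' t - x t|)) _ _ _ (cvg_cst _) Dc2).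
  near=> k; rewrite /cst/= -(subrKA (X k.+1 t)).
  apply: le_trans (ler_normD _ _) _; apply: lerD; last by rewrite distrC xX.
  rewrite exprSr invfM mulrA; apply: step => // ?.
  by move=> s0; rewrite /x' max_r// xX.
exists (T x'); split => //.
  exact: continuous_subspaceT.
move=> t t0; rewrite yx ?ltW//.
by have := dy t t0; rewrite /x' max_r// ltW.
Unshelve. all: by end_near. Qed.

End Picard.

(** * Locally Lipschitz functions *)

Section LocallyLipschitz.
Context {R : realType}.

(** With one ball and one nonnegative constant at each point in place of a filter
of constants, the constants can be added and multiplied. *)
Lemma locally_lipschitzP (V W : normedModType R) (f : V -> W) :
  locally_lipschitz f <-> forall x, exists M e, [/\ 0 <= M, 0 < e &
    forall y z, `|x - y| < e -> `|x - z| < e -> `|f y - f z| <= M * `|y - z|].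
Proof.
split=> [lf x|lf x].
- have [U /nbhs_normP[e/= e0 eU]] := lf x.
  move=> /pinfty_ex_gt0[M M0 HM]; exists M, e; split => //; first exact: ltW.
  by move=> y z xy xz; apply: (HM (y, z)); split; exact: eU.
- have [M [e [M0 e0 HM]]] := lf x; exists (ball_ Num.norm x e).
    by apply/nbhs_normP; exists e.
  apply: klipschitzW.
    by apply: (@globally_properfilter _ _ (x, x)); rewrite /= subrr normr0.
  by move=> [y z] /= [xy xz]; exact: HM.
Qed.

Lemma locally_lipschitz_cst (V W : normedModType R) (a : W) :
  locally_lipschitz (fun _ : V => a).
Proof.
apply/locally_lipschitzP => x; exists 0, 1; split => // y z _ _.
by rewrite subrr normr0 mul0r.
Qed.

Lemma locally_lipschitzD (V W : normedModType R) (f g : V -> W) :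
  locally_lipschitz f -> locally_lipschitz g ->
  locally_lipschitz (fun x => f x + g x).
Proof.
move=> /locally_lipschitzP lf /locally_lipschitzP lg; apply/locally_lipschitzP => x.
have [M [e [M0 e0 Hf]]] := lf x; have [N [d [N0 d0 Hg]]] := lg x.
exists (M + N), (Num.min e d); split; rewrite ?addr_ge0 ?lt_min ?e0 ?d0//.
move=> y z; rewrite !lt_min => /andP[xy xy'] /andP[xz xz'].
rewrite opprD addrACA mulrDl; apply: le_trans (ler_normD _ _) _.
by rewrite lerD ?Hf ?Hg.
Qed.

Lemma locally_lipschitz_sum (V W : normedModType R) n (f : 'I_n -> V -> W) :
  (forall i, locally_lipschitz (f i)) ->
  locally_lipschitz (fun x => \sum_i f i x).
Proof.
elim: n f => [|n IH] f lf.
  have -> : (fun x => \sum_(i < 0) f i x) = (fun=> 0).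
    by apply/funext => x; rewrite big_ord0.
  exact: locally_lipschitz_cst.
have -> : (fun x => \sum_i f i x) =
    (fun x => f ord0 x + \sum_i f (lift ord0 i) x).
  by apply/funext => x; rewrite big_ord_recl.
by apply: locally_lipschitzD => //; apply: IH => i.
Qed.

Lemma locally_lipschitzM (V : normedModType R) (f g : V -> R) :
  locally_lipschitz f -> locally_lipschitz g ->
  locally_lipschitz (fun x => f x * g x).
Proof.
move=> /locally_lipschitzP lf /locally_lipschitzP lg; apply/locally_lipschitzP => x.
have [M [e [M0 e0 Hf]]] := lf x; have [N [d [N0 d0 Hg]]] := lg x.
exists ((`|f x| + M * e) * N + (`|g x| + N * d) * M), (Num.min e d).
split; rewrite ?lt_min ?e0 ?d0//.
  by rewrite addr_ge0// mulr_ge0// addr_ge0// mulr_ge0// ltW.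
move=> y z; rewrite !lt_min => /andP[xy xy'] /andP[xz xz'].
have -> : f y * g y - f z * g z = f y * (g y - g z) + g z * (f y - f z) by ring.
apply: le_trans (ler_normD _ _) _; rewrite !normrM mulrDl -!mulrA.
have bound (W : normedModType R) (k : V -> W) (C r : R) u : 0 <= C ->
    (forall y z, `|x - y| < r -> `|x - z| < r -> `|k y - k z| <= C * `|y - z|) ->
    0 < r -> `|x - u| < r -> `|k u| <= `|k x| + C * r.
  move=> C0 Hk r0 xu; rewrite -[k u](subrK (k x)) addrC.
  apply: le_trans (ler_normD _ _) _; rewrite lerD2l.
  apply: le_trans (Hk _ _ xu _) _; first by rewrite subrr normr0.
  by rewrite ler_wpM2l// distrC ltW.
apply: lerD; apply: ler_pM => //.
- exact: bound xy.
- exact: Hg.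
- exact: bound xz'.
- exact: Hf.
Qed.

Lemma locally_lipschitz_entry (V : normedModType R) m n (f : V -> 'M[R]_(m, n)) i j :
  locally_lipschitz f -> locally_lipschitz (fun x => f x i j).
Proof.
move=> /locally_lipschitzP lf; apply/locally_lipschitzP => x.
have [M [e [M0 e0 Hf]]] := lf x; exists M, e; split => // y z xy xz.
apply: le_trans (Hf _ _ xy xz).
by have := mx_entry_norm_le (f y - f z) i j; rewrite !mxE.
Qed.

Lemma locally_lipschitz_col (V : normedModType R) n (f : V -> 'cV[R]_n) :
  (forall i, locally_lipschitz (fun x => f x i 0)) -> locally_lipschitz f.
Proof.
move=> lf; apply/locally_lipschitzP => x.
have /choice[M HM] i := (locally_lipschitzP _).1 (lf i) x.
have /choice[e He] i := HM i.
exists (\sum_i M i), (\big[Num.min/1]_i e i); split.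
- by apply: sumr_ge0 => i _; have [] := He i.
- by apply/bigmin_gtP; split => // i _; have [] := He i.
- move=> y z /bigmin_gtP[_ xy] /bigmin_gtP[_ xz].
  have M0 i : 0 <= M i by have [] := He i.
  apply/mx_norm_leP => [|i]; first by rewrite mulr_ge0// sumr_ge0.
  have [_ _ H] := He i.
  rewrite !mxE; apply: le_trans (H _ _ (xy i isT) (xz i isT)) _.
  by rewrite ler_wpM2r// (bigD1 i)//= lerDl sumr_ge0.
Qed.

Lemma closed_ball_compact n (M : R) : compact [set x : 'cV[R]_n | `|x| <= M].
Proof.
have [M0|M0] := ltP M 0.
  have -> : [set x : 'cV[R]_n | `|x| <= M] = set0; last exact: compact0.
  by apply/seteqP; split => // x /= xM; have := lt_le_trans M0 (normr_ge0 x); rewrite ltNge xM.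
have -> : [set x : 'cV[R]_n | `|x| <= M] =
    (@trmx R 1 n) @` [set v : 'rV[R]_n | forall i, `[- M, M]%classic (v ord0 i)].
  apply/seteqP; split => [x /= xM|_ [v/= Hv <-]].
    exists x^T; last exact: trmxK.
    move=> i; rewrite /= in_itv/= mxE -ler_norml.
    exact: (mx_norm_leP x M0).1.
  apply/mx_norm_leP => // i; rewrite mxE.
  by have := Hv i; rewrite /= in_itv/= -ler_norml.
apply: continuous_compact; last first.
  apply: (@rV_compact _ _ (fun=> `[- M, M]%classic)) => _.
  exact: segment_compact.
apply: continuous_subspaceT; apply: continuous_col => i.
have -> : (fun x : 'rV[R]_n => x^T i 0) = (fun x => x 0 i).
  by apply/funext => x; rewrite mxE.
exact: coord_continuous.
Qed.

(** Compactness makes the local radii and constants uniform, which settles close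
points; for points at distance at least [1 / M] the bound on [f] suffices. *)
Lemma locally_lipschitz_compact (V W : normedModType R) (f : V -> W) (C : set V) :
  compact C -> locally_lipschitz f -> exists2 M : R, 0 <= M &
    forall x y, C x -> C y -> `|f x| <= M /\ `|f x - f y| <= M * `|x - y|.
Proof.
move=> cC /locally_lipschitzP lf.
pose P (M : R) x := `|f x| <= M /\
  forall y, `|x - y| < M^-1 -> `|f x - f y| <= M * `|x - y|.
have H : \forall M \near +oo, C `<=` P M.
  apply: (compact_near_coveringP C).1 => // x Cx.
  have [M [e [M0 e0 Hf]]] := lf x.
  near=> x' N => /=.
  have xx' : `|x - x'| < e / 2.
    by near: x'; apply/nbhs_normP; exists (e / 2) => //=; rewrite divr_gt0.
  have N0 : 0 < N by [].
  have NM : M <= N by [].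
  have NF : `|f x| + M * e <= N by [].
  have Ne : 2 / e <= N by [].
  have xx'e : `|x - x'| < e by lra.
  split.
    rewrite -[f x'](subrK (f x)) addrC.
    apply: le_trans (ler_normD _ _) _; apply: le_trans NF; rewrite lerD2l.
    apply: le_trans (Hf _ _ xx'e _) _; first by rewrite subrr normr0.
    by rewrite ler_wpM2l// distrC ltW.
  move=> y x'y; apply: le_trans (Hf _ _ xx'e _) _; last by rewrite ler_wpM2r.
  have : N^-1 <= e / 2 by rewrite -[leRHS]invrK lef_pV2 ?posrE ?invr_gt0 ?divr_gt0// invf_div.
  have := ler_normD (x - x') (x' - y); rewrite subrKA.
  lra.
have [M M0 HM] := pinfty_ex_gt0 H.
exists (M + 2 * M * M).
  by rewrite addr_ge0 ?mulr_ge0// ltW.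
move=> x y Cx Cy; have [fx Hx] := HM _ Cx; have [fy Hy] := HM _ Cy.
have MM : 0 <= 2 * M * M by rewrite !mulr_ge0// ltW.
split; first by apply: le_trans fx _; rewrite lerDl.
have [xy|xy] := ltP `|x - y| M^-1.
  by apply: le_trans (Hx _ xy) _; rewrite ler_wpM2r// lerDl.
apply: (@le_trans _ _ (2 * M)).
  by apply: le_trans (ler_normB _ _) _; lra.
apply: (@le_trans _ _ (2 * M * M * `|x - y|)); last first.
  by rewrite ler_wpM2r// lerDr ltW.
rewrite -mulrA ler_peMr//; first by rewrite mulr_ge0// ltW.
by rewrite -ler_pdivrMl// mulr1.
Unshelve. all: by end_near. Qed.

End LocallyLipschitz.

(** * A Lyapunov theorem *)

Section Lyapunov.
Context {R : realType}.

Lemma is_derive_along n (V : 'cV[R]_n -> R) (x : R -> 'cV[R]_n) (t : R) dx :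
  differentiable V (x t) -> is_derive t (1:R) x dx ->
  is_derive t (1:R) (V \o x) ('D_dx V (x t)).
Proof.
move=> dV [xd <-]; have dxt : differentiable x t by apply/derivable1_diffP.
have dVx : differentiable (V \o x) t by exact: differentiable_comp.
apply: DeriveDef; first exact/derivable1_diffP.
by rewrite !deriveE// diff_comp.
Qed.

(** [exp (c t) V(x(t))] has a nonpositive derivative. *)
Lemma lyapunov_decay n (F : 'cV[R]_n -> 'cV[R]_n) (V : 'cV[R]_n -> R) (c : R) x0 x :
  (forall y, differentiable V y) ->
  (forall y, 'D_(F y) V y <= - c * V y) ->
  is_solution F x0 x ->
  forall t, 0 <= t -> expR (c * t) * V (x t) <= V x0.
Proof.
move=> dV Vdec [x_0 xc dx] t t0.
have -> : V x0 = expR (c * 0) * V (x 0) by rewrite mulr0 expR0 mul1r x_0.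
pose E (t : R) := 1 * expR (c * t).
have EE s : E s = expR (c * s) by rewrite /E mul1r.
have dE (s : R) : is_derive s (1:R) E (c * E s) by exact: is_derive_scaled_exp.
have Ec : continuous E.
  by move=> s; apply/differentiable_continuous/derivable1_diffP; exact: ex_derive.
rewrite -!EE.
apply: (@nonincreasing_of_derive_le0 R (E * (V \o x))
  (fun t => E t * 'D_(F (x t)) V (x t) + V (x t) * (c * E t))) => //.
- move=> s; apply: cvgM; first exact: continuous_subspaceT Ec s.
  have Vc : {for x s, continuous V} := differentiable_continuous (dV (x s)).
  exact: (cvg_comp _ _ (xc s) Vc).
- move=> s s0; have ? := is_derive_along (dV (x s)) (dx s s0).
  exact: is_deriveM.
- move=> s s0; have E0 : 0 < E s by rewrite EE expR_gt0.
  have := Vdec (x s); set d := 'D_ _ _ _; set W := V _ => dW.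
  have : E s * d <= E s * (- c * W) by rewrite ler_wpM2l// ltW.
  lra.
Qed.

Lemma clamp_lipschitz (a b : R) :
  `|Num.max 0 (Num.min 1 a) - Num.max 0 (Num.min 1 b)| <= `|a - b|.
Proof.
have H1 := ler_norm (a - b); have := ler_norm (b - a); rewrite distrC => H2.
rewrite ler_norml; apply/andP.
by case: (leP 1 a) => ?; case: (leP 1 b) => ?; rewrite ?(max_r ler01);
  case: (leP 0 a) => ?; case: (leP 0 b) => ?; split; lra.
Qed.

(** The cutoff factor is nonnegative, so multiplying by it preserves the sign of
the derivative of a Lyapunov function along the field. It vanishes outside the
ball of radius [M + 1], on which [F] has uniform constants. *)
Lemma cutoff_lipschitz n (F : 'cV[R]_n -> 'cV[R]_n) (M : R) :
  locally_lipschitz F ->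
  exists chi : 'cV[R]_n -> R, [/\ forall x, 0 <= chi x,
    forall x, `|x| <= M -> chi x = 1 &
    exists L, forall x y, `|chi x *: F x - chi y *: F y| <= L * `|x - y| ].
Proof.
move=> lF; pose chi (x : 'cV[R]_n) := Num.max 0 (Num.min 1 (M + 1 - `|x|)).
have [B B0 HB] := locally_lipschitz_compact (@closed_ball_compact R n (M + 1)) lF.
have chi0 x : 0 <= chi x by rewrite le_max lexx.
have chi1 x : chi x <= 1 by rewrite ge_max ler01 ge_min lexx.
have chi_out x : ~ (`|x| <= M + 1) -> chi x = 0.
  move=> /negP; rewrite -ltNge => xM; rewrite /chi max_l// ge_min.
  by apply/orP; right; lra.
have chiL x y : `|chi x - chi y| <= `|x - y|.
  apply: le_trans (clamp_lipschitz _ _) _.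
  rewrite (_ : _ - _ = `|y| - `|x|); last by ring.
  by rewrite distrC; exact: ler_dist_dist.
exists chi; split => // [x xM|].
  by rewrite /chi min_l ?max_r//; lra.
exists (B + B) => x y.
have edge x' y' : `|x'| <= M + 1 -> `|(chi x' - chi y') *: F x'| <= B * `|x' - y'|.
  move=> Cx; have [Fx _] := HB _ _ Cx Cx.
  by rewrite normrZ mulrC ler_pM.
have [Cx|nCx] := pselect (`|x| <= M + 1); last first.
  rewrite (chi_out _ nCx) scale0r.
  have [Cy|nCy] := pselect (`|y| <= M + 1); last first.
    by rewrite (chi_out _ nCy) scale0r subrr normr0 mulr_ge0// addr_ge0.
  have := edge y x Cy; rewrite (chi_out _ nCx) subr0 sub0r normrN distrC.
  move=> /le_trans; apply; rewrite mulrDl lerDl mulr_ge0//.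
have [Cy|nCy] := pselect (`|y| <= M + 1); last first.
  have := edge x y Cx; rewrite (chi_out _ nCy) scale0r !subr0.
  by move=> /le_trans; apply; rewrite mulrDl lerDl mulr_ge0.
have -> : chi x *: F x - chi y *: F y =
    (chi x - chi y) *: F x + chi y *: (F x - F y).
  by rewrite scalerBl scalerBr subrKA.
rewrite mulrDl; apply: le_trans (ler_normD _ _) _; apply: lerD; first exact: edge.
have [_ FL] := HB _ _ Cx Cy; apply: le_trans FL.
by rewrite normrZ ger0_norm// ler_piMl.
Qed.

(** Existence up to infinity needs no continuation argument: the cut-off field has
a global solution, along which [V] does not increase, so this solution stays in
the sublevel set of [V x0], where the cutoff factor is 1, and solves the original
equation. Convergence of every solution is the exponential decay of [V]. *)
Lemma lyapunov_GAS n (F : 'cV[R]_n -> 'cV[R]_n) (V : 'cV[R]_n -> R) (c : R) :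
  locally_lipschitz F -> (forall y, differentiable V y) ->
  (forall y, 0 <= V y) -> 0 < c ->
  (forall y, 'D_(F y) V y <= - c * V y) ->
  (forall C : R, exists M : R, forall y, V y <= C -> `|y| <= M) ->
  (forall e : R, 0 < e -> exists2 d : R, 0 < d & forall y, V y <= d -> `|y| <= e) ->
  forall x0, (exists x, is_solution F x0 x) /\
    (forall x, is_solution F x0 x -> x t @[t --> +oo] --> (0 : 'cV[R]_n)).
Proof.
move=> lF dV V0 c0 Vdec Vproper Vsmall x0; split.
- have [M HM] := Vproper (V x0).
  have [chi [chi0 chi1 [L HL]]] := cutoff_lipschitz M lF.
  have [x xsol] := global_solution x0 HL; exists x.
  (* [V] does not increase along the cut-off field: rate 0. *)
  have inball t : 0 <= t -> `|x t| <= M.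
    move=> t0; apply: HM.
    have := @lyapunov_decay n (fun y => chi y *: F y) V 0 x0 x dV _ xsol t t0.
    rewrite mul0r expR0 mul1r; apply => y.
    rewrite deriveE// linearZ/= -deriveE// oppr0 mul0r mulr_ge0_le0//.
    by apply: le_trans (Vdec y) _; rewrite mulNr oppr_le0 mulr_ge0// ltW.
  have [x_0 xc dx] := xsol; split => // t t0.
  by have := dx t t0; rewrite chi1 ?scale1r// inball// ltW.
- move=> x xsol; apply/cvgrPdist_le => e e0.
  have [d d0 Hd] := Vsmall e e0.
  near=> t; rewrite sub0r normrN; apply: Hd.
  have t0 : 0 < t by [].
  have := lyapunov_decay dV Vdec xsol (ltW t0).
  have ct : 0 < c * t by rewrite mulr_gt0.
  (* [exp (c t) >= c t] turns the exponential decay into [V (x t) <= V x0 / (c t)]. *)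
  have td : V x0 <= d * (c * t).
    by rewrite mulrA mulrC -ler_pdivrMr ?mulr_gt0//.
  have := expR_ge1Dx (c * t); have := V0 (x t).
  move=> Vt E1 EV.
  rewrite -(ler_pM2r ct); apply: le_trans td; apply: le_trans EV.
  rewrite mulrC ler_wpM2r//; lra.
Unshelve. all: by end_near. Qed.

End Lyapunov.

(** * Quadratic forms, monomial bases and Kronecker products *)

Section Algebra.
Context {R : realType}.

Lemma quadformE n (A : 'M[R]_n) (v : 'cV[R]_n) :
  (v^T *m A *m v) 0 0 = \sum_i \sum_j A i j * (v i 0 * v j 0).
Proof.
rewrite mxE exchange_big /=; apply: eq_bigr => j _.
rewrite mxE mulr_suml; apply: eq_bigr => i _.
by rewrite !mxE mulrA; ring.
Qed.

Lemma quadform_le n (A : 'M[R]_n) :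
  exists2 C : R, 0 < C & forall v : 'cV[R]_n, (v^T *m A *m v) 0 0 <= C * `|v| ^+ 2.
Proof.
exists (1 + \sum_i \sum_j `|A i j|).
  by rewrite ltr_wpDr// sumr_ge0// => i _; rewrite sumr_ge0.
move=> v; rewrite quadformE mulrDl mul1r.
apply: (@le_trans _ _ ((\sum_i \sum_j `|A i j|) * `|v| ^+ 2)); last first.
  by rewrite lerDr exprn_ge0.
rewrite mulr_suml; apply: ler_sum => i _; rewrite mulr_suml; apply: ler_sum => j _.
apply: le_trans (ler_norm _) _; rewrite !normrM ler_wpM2l// expr2.
by rewrite ler_pM// mx_entry_norm_le.
Qed.

Lemma monomial_differentiable n (a : 'I_n -> nat) (x : 'cV[R]_n) :
  differentiable (monomial a) x.
Proof.
rewrite /monomial; elim: (index_enum _) => [|i s IH].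
  have -> : (fun y : 'cV[R]_n => \prod_(i <- [::]) y i 0 ^+ a i) = cst 1.
    by apply/funext => y; rewrite big_nil.
  exact: differentiable_cst.
have -> : (fun y : 'cV[R]_n => \prod_(j <- i :: s) y j 0 ^+ a j) =
    (fun y : 'cV[R]_n => y i 0 : R) ^+ a i * (fun y => \prod_(j <- s) y j 0 ^+ a j).
  by rewrite exprfctE; apply/funext => y; rewrite big_cons.
apply: differentiableM => //.
case: (a i) => [|k]; first by rewrite expr0; exact: differentiable_cst.
by apply: differentiableX; exact: differentiable_coord.
Qed.

(** A strict basis does not vanish at the [i]-th unit vector; a component that
does not vanish there involves no other variable, and it is not constant because
the basis vanishes at 0. Hence every variable has a pure power in the basis. *)
Lemma strict_basis_coercive n m (z : 'cV[R]_n -> 'cV[R]_m) :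
  monomial_basis z -> strict_basis z -> exists a : 'I_n -> nat,
    (forall i, 0 < a i)%N /\ forall (x : 'cV[R]_n) i, `|x i 0| ^+ a i <= `|z x|.
Proof.
move=> zmon zstrict.
suff /choice[a Ha] i : exists k, (0 < k)%N /\ forall x : 'cV[R]_n, `|x i 0| ^+ k <= `|z x|.
  by exists a; split => [i|x i]; have [] := Ha i.
have e0 : delta_mx i 0 != 0 :> 'cV[R]_n.
  by apply/eqP => /matrixP/(_ i 0); rewrite !mxE !eqxx => /eqP; rewrite oner_eq0.
have [j zj] : exists j, z (delta_mx i 0) j 0 != 0.
  apply/not_existsP => H; move/eqP: e0; apply; apply/zstrict/colP => j.
  by rewrite mxE; apply/eqP/negP => /negP/H.
have [b zb] := zmon j 0.
have bi0 k : k != i -> b k = 0%N.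
  move=> ki; apply/eqP/negP => /negP bk; move/eqP: zj; apply.
  rewrite zb /monomial (bigD1 k)//= mxE (negbTE ki).
  by rewrite expr0n (negbTE bk) mul0r.
have zE x : z x j 0 = x i 0 ^+ b i.
  rewrite zb /monomial (bigD1 i)//= big1 ?mulr1// => k ki.
  by rewrite bi0// expr0.
exists (b i); split.
  rewrite lt0n; apply/eqP => bi.
  have /colP/(_ j) : z 0 = 0 by apply/zstrict.
  by rewrite zE bi expr0 mxE => /eqP; rewrite oner_eq0.
by move=> x; rewrite -normrX -zE; exact: mx_entry_norm_le.
Qed.

Lemma derive_jacE n m (z : 'cV[R]_n -> 'cV[R]_m) i x (v : 'cV[R]_n) :
  differentiable (fun y => z y i 0) x ->
  'D_v (fun y => z y i 0) x = (jac z x *m v) i 0.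
Proof.
move=> dz; rewrite deriveE// mxE.
have {1}-> : v = \sum_j v j 0 *: delta_mx j 0.
  by rewrite {1}(matrix_sum_delta v); apply: eq_bigr => j _; rewrite big_ord1.
rewrite linear_sum; apply: eq_bigr => j _.
by rewrite linearZ mxE deriveE// mulrC.
Qed.

Lemma quadform_derive n m (P : 'M[R]_m) (z : 'cV[R]_n -> 'cV[R]_m) x (v : 'cV[R]_n) :
  P^T = P -> (forall i, differentiable (fun y => z y i 0) x) ->
  differentiable (fun y => ((z y)^T *m P *m z y) 0 0) x /\
  'D_v (fun y => ((z y)^T *m P *m z y) 0 0) x =
    2 * ((z x)^T *m (P *m (jac z x *m v))) 0 0.
Proof.
move=> Psym dz.
pose f i (y : 'cV[R]_n) := z y i 0.
have -> : (fun y => ((z y)^T *m P *m z y) 0 0) =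
    \sum_i \sum_j (P i j *: (f i * f j)).
  apply/funext => y; rewrite quadformE fct_sumE; apply: eq_bigr => i _.
  by rewrite fct_sumE; apply: eq_bigr => j _.
split.
  apply: differentiable_sum => i; apply: differentiable_sum => j.
  by apply: differentiableZ; apply: differentiableM; exact: dz.
have df i : is_derive x v (f i) ((jac z x *m v) i 0).
  apply: DeriveDef; first by apply: diff_derivable; exact: dz.
  by apply: derive_jacE; exact: dz.
set w := jac z x *m v in df *.
have dP i j : is_derive x v (P i j *: (f i * f j))
    (P i j * (f i x * w j 0 + f j x * w i 0)).
  exact: (is_deriveZ (P i j) (is_deriveM (df i) (df j))).
have dsum i := is_derive_sum (dP i).
have -> := @derive_val _ _ _ _ _ _ _ (is_derive_sum dsum).
have E1 : \sum_i \sum_j P i j * (f i x * w j 0) = ((z x)^T *m (P *m w)) 0 0.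
  rewrite mxE; apply: eq_bigr => i _; rewrite !mxE mulr_sumr; apply: eq_bigr => j _.
  by rewrite /f; ring.
rewrite mulr_natl mulr2n -E1.
rewrite [X in _ = _ + X]exchange_big /= -big_split /=; apply: eq_bigr => i _.
rewrite -big_split /=; apply: eq_bigr => j _.
have -> : P j i = P i j by rewrite -{1}Psym mxE.
by rewrite mulrDr.
Qed.

(** The constant is the minimum of the form on the unit sphere of the sup norm,
which is compact. *)
Lemma posdefmx_coercive n (A : 'M[R]_n) : posdefmx A ->
  exists2 m : R, 0 < m & forall v : 'cV[R]_n, m * `|v| ^+ 2 <= (v^T *m A *m v) 0 0.
Proof.
move=> [Asym Apos].
have [[u u0]|all0] := pselect (exists v : 'cV[R]_n, v != 0); last first.
  exists 1 => // v; have -> : v = 0.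
    by apply/eqP/negP => /negP v0; apply: all0; exists v.
  by rewrite normr0 expr0n/= mulr0 mulmx0 mxE.
pose S := [set v : 'cV[R]_n | `|v| = 1].
pose Q (v : 'cV[R]_n) := (v^T *m A *m v) 0 0.
have QZ a v : Q (a *: v) = a ^+ 2 * Q v.
  by rewrite /Q [(a *: v)^T]linearZ/= -scalemxAl -scalemxAl -scalemxAr !mxE mulrA expr2.
have normalize v : v != 0 -> S (`|v|^-1 *: v).
  move=> v0; rewrite /S/= normrZ ger0_norm ?invr_ge0// mulVf// normr_eq0//.
have Sc : compact S.
  apply: subclosed_compact (@closed_ball_compact R n 1) _; last by move=> v /= ->.
  apply: (@closed_comp _ _ (fun v : 'cV[R]_n => `|v|) [set x | x = 1]).
    by move=> v _; exact: norm_continuous.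
  exact: closed_eq.
have Qc : continuous Q.
  move=> v; apply: differentiable_continuous.
  by apply: (quadform_derive (z := id) 0 _ _).1 => // i; exact: differentiable_coord.
have [v0 Sv0 Hv0] : exists2 c, c \in S & forall t, t \in S -> Q c <= Q t.
  apply: compact_EVT_min => //; last exact: continuous_subspaceT.
  by exists (`|u|^-1 *: u); exact: normalize.
exists (Q v0).
  apply: Apos; apply/eqP => v00; move: Sv0; rewrite inE /S/= v00 normr0 => /eqP.
  by rewrite eq_sym oner_eq0.
move=> v; have [->|vn0] := eqVneq v 0.
  by rewrite normr0 expr0n/= mulr0 mulmx0 mxE.
have := Hv0 _ (mem_set (normalize _ vn0)); rewrite QZ exprVn.
by rewrite mulrC ler_pdivlMr// exprn_gt0// normr_gt0.
Qed.

Lemma kronE m p q (a : 'cV[R]_m) (B : 'M[R]_(p, q)) i j k :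
  kron a B (mxtens_index (i, j)) k = a i 0 * B j k.
Proof.
rewrite /kron castmxE /= cast_ord_id mxE mxtens_indexK ord1 /=.
by congr (_ * B j _); apply: val_inj; rewrite /= modn_small.
Qed.

(** The identity [vec (A X B) = (B^T (x) A) vec X], which rewrites the controller
as a matrix acting on the basis. *)
Lemma kron_mul_unvec m p q (a : 'cV[R]_m) (Z : 'M[R]_(q, p)) (w : 'cV[R]_(m * p)) :
  (kron a Z^T)^T *m w = Z *m unvec w *m a.
Proof.
apply/colP => k; rewrite !mxE.
rewrite (reindex (@mxtens_index m p)) /=; last first.
  by exists (@mxtens_unindex m p) => ? _; rewrite (mxtens_indexK, mxtens_unindexK).
transitivity (\sum_i \sum_j a i 0 * Z k j * w (mxtens_index (i, j)) 0).
  rewrite pair_big /=; apply: eq_bigr => -[i j] _.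
  by rewrite !mxE kronE !mxE.
apply: eq_bigr => i _; rewrite mxE mulr_suml; apply: eq_bigr => j _.
by rewrite mxE; ring.
Qed.

Lemma strict_basis_proper n m (z : 'cV[R]_n -> 'cV[R]_m) :
  monomial_basis z -> strict_basis z -> forall x, `|x| <= 1 + `|z x|.
Proof.
move=> zmon zstrict x; have [a [a0 Ha]] := strict_basis_coercive zmon zstrict.
apply/mx_norm_leP => [|i]; first by rewrite addr_ge0.
have [x1|x1] := leP `|x i 0| 1; first by apply: le_trans x1 _; rewrite lerDl.
apply: (@le_trans _ _ `|z x|); last by rewrite lerDr.
apply: le_trans (Ha x i); rewrite -[leLHS]expr1.
by rewrite ler_weXn2l// ltW.
Qed.

Lemma strict_basis_small n m (z : 'cV[R]_n -> 'cV[R]_m) :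
  monomial_basis z -> strict_basis z -> forall e : R, 0 < e ->
  exists2 d : R, 0 < d & forall x, `|z x| <= d -> `|x| <= e.
Proof.
move=> zmon zstrict e e0; have [a [a0 Ha]] := strict_basis_coercive zmon zstrict.
pose e1 := Num.min 1 e.
have e10 : 0 < e1 by rewrite lt_min ltr01.
exists (e1 ^+ \sum_i a i); first by rewrite exprn_gt0.
move=> x zx; apply/mx_norm_leP => [|i]; first exact: ltW.
(* [e1 <= 1], so the large exponent [\sum_i a i] works for all variables. *)
apply: (@le_trans _ _ e1); last by rewrite ge_min lexx orbT.
rewrite -(@ler_pXn2r _ (a i)) ?nnegrE ?(ltW e10)//.
apply: le_trans (Ha x i) _; apply: le_trans zx _.
rewrite ler_wiXn2l ?(ltW e10)//; first by rewrite ge_min lexx.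
by rewrite (bigD1 i)//= leq_addr.
Qed.

End Algebra.

(** * The closed loop and its Lyapunov function *)

Section ClosedLoop.
Context {R : realType}.

(** Outside the feasible set the penalty equals [rho_ub]. *)
Lemma penalty_lt_feasible K m n (kappa rho_ub : R) (P : 'M[R]_m) (T : 'I_K -> 'M[R]_n) :
  penalty kappa rho_ub P T < rho_ub ->
  posdefmx (P + P^T) /\ forall k, posdefmx (T k).
Proof. by rewrite /penalty; case: asboolP => //; rewrite ltxx. Qed.

Lemma posdefmx_half n (P : 'M[R]_n) :
  posdefmx (P + P^T) -> posdefmx (2^-1 *: (P + P^T)).
Proof.
move=> [sym pos]; split; first by rewrite [LHS]linearZ/= sym.
by move=> v v0; rewrite -scalemxAr -scalemxAl mxE mulr_gt0 ?pos// invr_gt0.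
Qed.

Lemma posdefmx_coercive_fam K n (T : 'I_K -> 'M[R]_n) : (forall k, posdefmx (T k)) ->
  exists2 m : R, 0 < m &
    forall k (v : 'cV[R]_n), m * `|v| ^+ 2 <= (v^T *m T k *m v) 0 0.
Proof.
move=> Tpos; have /choice[m Hm] k : exists m : R, 0 < m /\
    forall v : 'cV[R]_n, m * `|v| ^+ 2 <= (v^T *m T k *m v) 0 0.
  by have [m m0 H] := posdefmx_coercive (Tpos k); exists m.
exists (\big[Num.min/1]_k m k).
  by apply/bigmin_gtP; split => // k _; have [] := Hm k.
move=> k v; have [_ H] := Hm k; apply: le_trans (H v).
by rewrite ler_wpM2r ?exprn_ge0// bigmin_le_cond.
Qed.

Lemma closed_loopE n p dz dZ du K (h : 'I_K -> 'cV[R]_p -> R)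
    (fk : 'I_K -> 'cV[R]_n -> 'cV[R]_n) (Gk : 'I_K -> 'cV[R]_n -> 'M[R]_(n, du))
    (Phi : 'cV[R]_n -> 'M[R]_(dz * dZ, du)) (z : 'cV[R]_n -> 'cV[R]_dz)
    (Z : 'cV[R]_n -> 'M[R]_(du, dZ)) (Fk : 'I_K -> 'cV[R]_n -> 'M[R]_(n, dz)) w x th :
  (forall k x, fk k x = Fk k x *m z x) ->
  (forall x, Phi x = kron (z x) (Z x)^T) ->
  closed_loop (polytopic h fk) (polytopic h Gk) Phi w x th =
  \sum_k h k th *: ((Fk k x + Gk k x *m Z x *m unvec w) *m z x).
Proof.
move=> hF hPhi; rewrite /closed_loop /polytopic /uhat hPhi kron_mul_unvec.
rewrite mulmx_suml -big_split /=; apply: eq_bigr => k _.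
by rewrite -scalemxAl -scalerDr hF mulmxDl !mulmxA.
Qed.

Lemma closed_loop_locally_lipschitz n p dw du K (h : 'I_K -> 'cV[R]_p -> R)
    (fk : 'I_K -> 'cV[R]_n -> 'cV[R]_n) (Gk : 'I_K -> 'cV[R]_n -> 'M[R]_(n, du))
    (Phi : 'cV[R]_n -> 'M[R]_(dw, du)) w th :
  (forall k, locally_lipschitz (fk k)) -> (forall k, locally_lipschitz (Gk k)) ->
  locally_lipschitz Phi ->
  locally_lipschitz ((closed_loop (polytopic h fk) (polytopic h Gk) Phi w)^~ th).
Proof.
move=> lf lG lPhi; apply: locally_lipschitz_col => i.
rewrite /closed_loop /polytopic /uhat.
have -> : (fun x => (\sum_k h k th *: fk k x +
      (\sum_k h k th *: Gk k x) *m ((Phi x)^T *m w)) i 0) =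
    (fun x => \sum_k h k th * fk k x i 0 +
      \sum_j (\sum_k h k th * Gk k x i j) * \sum_l Phi x l j * w l 0).
  apply/funext => x; rewrite !mxE summxE; congr (_ + _).
    by apply: eq_bigr => k _; rewrite mxE.
  apply: eq_bigr => j _; rewrite summxE mxE; congr (_ * _).
    by apply: eq_bigr => k _; rewrite mxE.
  by apply: eq_bigr => l _; rewrite mxE.
apply: locally_lipschitzD.
  apply: locally_lipschitz_sum => k; apply: locally_lipschitzM.
    exact: locally_lipschitz_cst.
  exact: locally_lipschitz_entry.
apply: locally_lipschitz_sum => j; apply: locally_lipschitzM.
  apply: locally_lipschitz_sum => k; apply: locally_lipschitzM.
    exact: locally_lipschitz_cst.
  exact: locally_lipschitz_entry.
apply: locally_lipschitz_sum => l; apply: locally_lipschitzM.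
  exact: locally_lipschitz_entry.
exact: locally_lipschitz_cst.
Qed.

(** The left-hand side is half the derivative of [z^T P' z] along the vertex field,
where [P'] is the symmetric part of [P]: the form of [Umx] is a dissipation
rate. *)
Lemma Umx_quadform n du dz dZ (z : 'cV[R]_n -> 'cV[R]_dz) (F : 'cV[R]_n -> 'M[R]_(n, dz))
    (G : 'cV[R]_n -> 'M[R]_(n, du)) (Z : 'cV[R]_n -> 'M[R]_(du, dZ)) x P w :
  (z x)^T *m (2^-1 *: (P + P^T) *m
    (jac z x *m ((F x + G x *m Z x *m unvec w) *m z x))) =
  - ((z x)^T *m Umx z F G Z x P w *m z x).
Proof. by rewrite /Umx mulmxN mulNmx opprK !mulmxA. Qed.

(** Since [zeta] has a component 1, every component of [z] is one of [xi]. *)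
Lemma nonredundant_form_norm_le n dz dzeta dxi (z : 'cV[R]_n -> 'cV[R]_dz)
    (zeta : 'cV[R]_n -> 'cV[R]_dzeta) (xi : 'cV[R]_n -> 'cV[R]_dxi) i0 :
  (forall x, zeta x i0 0 = 1) ->
  nonredundant_form xi (fun x => kron (zeta x) (z x)) ->
  forall x, `|z x| <= `|xi x|.
Proof.
move=> zeta1 [_ _ xi_kron _] x; apply/mx_norm_leP => // j.
have [i xiE] := xi_kron (mxtens_index (i0, j)).
have <- : xi x i 0 = z x j 0 by rewrite xiE kronE zeta1 mul1r.
exact: mx_entry_norm_le.
Qed.

End ClosedLoop.

(** * Robust stability of the iterates *)

Theorem theorem4 (R : realType)
  (dtheta dx du dz dZ dzeta dxi dv dr K : nat)
  (* random parameter and random initial state *)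
  (S : set 'cV[R]_dtheta)
  (d1 : measure_display) (Omega1 : measurableType d1)
  (P1 : probability Omega1 R) (theta : Omega1 -> 'cV[R]_dtheta)
  (htheta : random_vector theta) (hthetaS : forall o, S (theta o))
  (d2 : measure_display) (Omega2 : measurableType d2)
  (P2 : probability Omega2 R) (x0 : Omega2 -> 'cV[R]_dx)
  (hx0 : random_vector x0)
  (hx0_moments : forall a : 'I_dx -> nat,
     P2.-integrable setT (fun o => (monomial a (x0 o))%:E))
  (* polytopic dynamics *)
  (hK : (0 < K)%N)
  (h : 'I_K -> 'cV[R]_dtheta -> R)
  (h_cont : forall k, {within S, continuous (h k)})
  (h_01 : forall k th, S th -> 0 <= h k th <= 1)
  (h_sum : forall th, S th -> \sum_k h k th = 1)
  (fk : 'I_K -> 'cV[R]_dx -> 'cV[R]_dx)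
  (fk_lip : forall k, locally_lipschitz (fk k))
  (fk0 : forall k, fk k 0 = 0)
  (Gk : 'I_K -> 'cV[R]_dx -> 'M[R]_(dx, du))
  (Gk_lip : forall k, locally_lipschitz (Gk k))
  (* controller, approximate cost and its coefficient selection *)
  (Phi : 'cV[R]_dx -> 'M[R]_(dz * dZ, du))
  (Phi_lip : locally_lipschitz Phi)
  (phi : 'cV[R]_dx -> 'cV[R]_dv) (phi_C1 : C1 phi) (phi0 : phi 0 = 0)
  (q : 'cV[R]_dx -> R) (q_cont : continuous q) (q_pos : globally_posdef q)
  (Rm : 'cV[R]_dx -> 'M[R]_du) (Rm_cont : continuous Rm)
  (Rm_pos : forall x, posdefmx (Rm x))
  (eta : R) (heta : 0 <= eta)
  (p : 'cV[R]_dx -> \bar R) (hp : admissible_weight p)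
  (v : 'cV[R]_(dz * dZ) -> 'cV[R]_dtheta -> 'cV[R]_dv)
  (hv : forall w th, S th ->
     argmin (bellman_residual p eta (fun x vt =>
       bellman (polytopic h fk) (polytopic h Gk) Phi phi q Rm x vt w th))
       (v w th))
  (* monomial bases *)
  (z : 'cV[R]_dx -> 'cV[R]_dz)
  (z_mon : monomial_basis z) (z_strict : strict_basis z)
  (zeta : 'cV[R]_dx -> 'cV[R]_dzeta)
  (zeta_mon : monomial_basis zeta)
  (hdzeta : (0 < dzeta)%N)
  (zeta1 : forall x, zeta x (Ordinal hdzeta) 0 = 1)
  (xi : 'cV[R]_dx -> 'cV[R]_dxi)
  (hxi : nonredundant_form xi (fun x => kron (zeta x) (z x)))
  (Z : 'cV[R]_dx -> 'M[R]_(du, dZ)) (Z_cont : continuous Z)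
  (GZ_poly : forall k, polynomial_mx (fun x => Gk k x *m Z x))
  (* SOS settings (i)-(iv) *)
  (Fk : 'I_K -> 'cV[R]_dx -> 'M[R]_(dx, dz))
  (Fk_poly : forall k, polynomial_mx (Fk k))
  (hFk : forall k x, fk k x = Fk k x *m z x)
  (hPhi : forall x, Phi x = kron (z x) (Z x)^T)
  (hU_span : forall P w k i j, exists c : 'rV[R]_(dzeta * dzeta), forall x,
     Umx z (Fk k) (Gk k) Z x P w i j = (c *m kron (zeta x) (zeta x)) 0 0)
  (hU_sos : exists P w, posdefmx P /\
     forall k, exists Sbar : 'M[R]_(dzeta * dz), posdefmx Sbar /\
       forall x, Umx z (Fk k) (Gk k) Z x P w + (Umx z (Fk k) (Gk k) Z x P w)^T =
         (kron (zeta x) 1%:M)^T *m Sbar *m kron (zeta x) 1%:M)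
  (* the matrices T_k *)
  (Cr : 'M[R]_(dr, (dxi * dxi.+1)./2)) (cr : R) (hcr : cr = 0 \/ cr = 1)
  (T : 'I_K -> 'cV[R]_(dz * dZ) -> 'M[R]_dz -> 'M[R]_(dr, K) -> 'M[R]_dxi)
  (hT : forall k w P r,
     unique (Tmx_system z xi (fun x => Umx z (Fk k) (Gk k) Z x P w)
               Cr cr (col k r))
            (T k w P r))
  (* penalty and objective *)
  (kappa rho_ub Jlb : R) (hkappa : 0 < kappa)
  (EJ : 'cV[R]_(dz * dZ) -> R)
  (hEJ : EJ = expected_cost P1 P2 theta x0 phi v)
  (rho g : 'cV[R]_(dz * dZ) -> 'M[R]_dz -> 'M[R]_(dr, K) -> R)
  (hrho : rho = fun w P r => penalty kappa rho_ub P (fun k => T k w P r))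
  (hg : g = fun w P r => EJ w + rho w P r)
  (* gradient method *)
  (w : nat -> 'cV[R]_(dz * dZ)) (P : nat -> 'M[R]_dz)
  (r : nat -> 'M[R]_(dr, K)) (alpha : nat -> R)
  (hP0 : posdefmx (P 0%N + (P 0%N)^T))
  (hT0 : forall k, posdefmx (T k (w 0%N) (P 0%N) (r 0%N)))
  (hg0 : g (w 0%N) (P 0%N) (r 0%N) < Jlb + rho_ub)
  (l : nat)
  (hw : forall j, (j < l)%N ->
     w j.+1 = w j - alpha j *: grad (fun w' => g w' (P j) (r j)) (w j))
  (hP : forall j, (j < l)%N ->
     P j.+1 = P j - alpha j *: grad (fun P' => rho (w j) P' (r j)) (P j))
  (hr : forall j, (j < l)%N ->
     r j.+1 = r j - alpha j *: grad (fun r' => rho (w j) (P j) r') (r j))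
  (hgl : g (w l) (P l) (r l) <= g (w 0%N) (P 0%N) (r 0%N))
  (hJl : Jlb <= EJ (w l)) :
  robustly_GAS S (closed_loop (polytopic h fk) (polytopic h Gk) Phi (w l)).
Proof.
(* The cost is at least [Jlb], so the penalty stays below [rho_ub]. *)
have [Psym Tpos] : posdefmx (P l + (P l)^T) /\
    forall k, posdefmx (T k (w l) (P l) (r l)).
  apply: (@penalty_lt_feasible _ _ _ _ kappa rho_ub); move: hgl hg0 hJl.
  by rewrite hg hrho; lra.
pose Pm := 2^-1 *: (P l + (P l)^T).
have Ppos : posdefmx Pm := posdefmx_half Psym.
have [mP mP0 HmP] := posdefmx_coercive Ppos.
have [CP CP0 HCP] := quadform_le Pm.
have [mT mT0 HmT] := posdefmx_coercive_fam Tpos.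
pose V y := ((z y)^T *m Pm *m z y) 0 0.
have z_diff y i : differentiable (fun y => z y i 0) y.
  have [a za] := z_mon i 0.
  have -> : (fun y => z y i 0) = monomial a by apply/funext.
  exact: monomial_differentiable.
have V_diff y v' := quadform_derive v' Ppos.1 (z_diff y).
have zxi := nonredundant_form_norm_le zeta1 hxi.
move=> th Sth.
apply: (@lyapunov_GAS _ _ _ V (2 * mT / CP)).
- exact: closed_loop_locally_lipschitz.
- by move=> y; have [] := V_diff y 0.
- by move=> y; apply: le_trans (HmP (z y)); rewrite mulr_ge0 ?exprn_ge0// ltW.
- by rewrite divr_gt0// mulr_gt0.
- move=> y.
  have [_ ->] := V_diff y (closed_loop (polytopic h fk) (polytopic h Gk) Phi (w l) y th).
  rewrite (closed_loopE h Gk (w l) y th hFk hPhi) !mulmx_sumr summxE.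
  have UT k : ((z y)^T *m (Pm *m (jac z y *m (h k th *:
      ((Fk k y + Gk k y *m Z y *m unvec (w l)) *m z y))))) 0 0 <=
      h k th * (- (mT * `|z y| ^+ 2)).
    rewrite -!scalemxAr mxE Umx_quadform.
    have [[xiU _ _] _] := hT k (w l) (P l) (r l).
    have /andP[hk0 _] := h_01 k th Sth.
    rewrite ler_wpM2l// mxE lerN2 -xiU; apply: le_trans (HmT _ _).
    by rewrite ler_pM2l// lerXn2r ?nnegrE// zxi.
  apply: (@le_trans _ _ (2 * (- (mT * `|z y| ^+ 2)))).
    rewrite ler_wpM2l//; apply: le_trans (ler_sum _ (fun k _ => UT k)) _.
    by rewrite -mulr_suml (h_sum th Sth) mul1r.
  have := HCP (z y); rewrite -/(V y) -ler_pdivrMl// => VC.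
  have : 2 * mT * (CP^-1 * V y) <= 2 * mT * `|z y| ^+ 2.
    by rewrite ler_wpM2l// mulr_ge0// ltW.
  lra.
- move=> C; exists (2 + C / mP) => y VyC.
  have zC : `|z y| ^+ 2 <= C / mP.
    by rewrite ler_pdivlMr// mulrC; apply: le_trans VyC; exact: HmP.
  apply: le_trans (strict_basis_proper z_mon z_strict y) _.
  have := sqr_ge0 (`|z y| - 1); nra.
- move=> e e0; have [d d0 Hd] := strict_basis_small z_mon z_strict e0.
  exists (mP * d ^+ 2) => [|y VyC]; first by rewrite mulr_gt0// exprn_gt0.
  apply: Hd; rewrite -(@ler_pXn2r _ 2) ?nnegrE ?(ltW d0)// -(ler_pM2l mP0).
  exact: le_trans (HmP _) VyC.
Qed.
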